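(* Let $F$ be a finitely generated free group and $\alpha:F\to F$ an injective endomorphism. Let $M_\alpha=\langle F,t\mid t^{-1}ft=\alpha(f),\ f\in F\rangle$, let $\kappa:F\to M_\alpha$ be the canonical embedding and $j:M_\alpha\to\widehat{M_\alpha}$ the canonical homomorphism to the profinite completion. Let $H$ be a finitely generated subgroup of $F$ with $\alpha(H)\subseteq H$, and let $\overline H$ denote the closure of $j\circ\kappa(H)$ in $\widehat{M_\alpha}$. Then for $w\in F$, $j\circ\kappa(w)\in\overline H$ if and only if there exists $n\in\mathbb N$ such that $\alpha^n(w)\in H$. *)

(* Defs.v *)
From Stdlib Require List.
From mathcomp Require Import all_boot.
Set Implicit Arguments. Unset Strict Implicit. Unset Printing Implicit Defensive.

Record AbsGroup := {
  gcar :> Type;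
  gmul : gcar -> gcar -> gcar;
  gone : gcar;
  ginv : gcar -> gcar;
  gmulA : forall x y z, gmul x (gmul y z) = gmul (gmul x y) z;
  gmul1 : forall x, gmul gone x = x;
  gmulV : forall x, gmul (ginv x) x = gone }.

Arguments gmul {a}. Arguments gone {a}. Arguments ginv {a}.

Definition is_hom (G K : AbsGroup) (f : G -> K) : Prop :=
  forall x y, f (gmul x y) = gmul (f x) (f y).

Definition is_free_on (F : AbsGroup) (n : nat) (b : 'I_n -> F) : Prop :=
  forall (G : AbsGroup) (v : 'I_n -> G),
    (exists phi : F -> G, is_hom phi /\ forall i, phi (b i) = v i) /\
    (forall phi psi : F -> G, is_hom phi -> is_hom psi ->
       (forall i, phi (b i) = psi (b i)) -> forall x, phi x = psi x).

Definition is_subgroup (G : AbsGroup) (H : G -> Prop) : Prop :=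
  H gone /\ (forall x y, H x -> H y -> H (gmul x y)) /\
  (forall x, H x -> H (ginv x)).

Definition gen_by (G : AbsGroup) (k : nat) (s : 'I_k -> G) (x : G) : Prop :=
  forall K : G -> Prop, is_subgroup K -> (forall i, K (s i)) -> K x.

Definition fg_subgroup (G : AbsGroup) (H : G -> Prop) : Prop :=
  is_subgroup H /\
  exists (k : nat) (s : 'I_k -> G), forall x, H x <-> gen_by s x.

(* (M, kappa, t) is the group  < F, t | t^-1 f t = alpha f (f in F) >,
   i.e. it satisfies the universal property of this presentation. *)
Definition is_mapping_torus (F : AbsGroup) (alpha : F -> F)
    (M : AbsGroup) (kappa : F -> M) (t : M) : Prop :=
  is_hom kappa /\
  (forall f, gmul (ginv t) (gmul (kappa f) t) = kappa (alpha f)) /\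
  (forall (G : AbsGroup) (psi : F -> G) (g : G), is_hom psi ->
     (forall f, gmul (ginv g) (gmul (psi f) g) = psi (alpha f)) ->
     exists phi : M -> G, is_hom phi /\ (forall f, phi (kappa f) = psi f)
                          /\ phi t = g) /\
  (forall (G : AbsGroup) (phi phi' : M -> G), is_hom phi -> is_hom phi' ->
     (forall f, phi (kappa f) = phi' (kappa f)) -> phi t = phi' t ->
     forall x, phi x = phi' x).

Definition fin_index_normal (M : AbsGroup) (N : M -> Prop) : Prop :=
  is_subgroup N /\
  (forall x y, N y -> N (gmul x (gmul y (ginv x)))) /\
  exists (k : nat) (r : 'I_k -> M), forall x, exists i, N (gmul (ginv (r i)) x).

Definition FIN (M : AbsGroup) := {N : M -> Prop | fin_index_normal N}.

(* Profinite completion: compatible families (x_N N)_N of cosets in the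
   finite quotients M/N (inverse limit), a subset of prod_N M/N. *)
Record profinite_elt (M : AbsGroup) := {
  pcoord : FIN M -> M -> Prop;
  pcoset : forall N : FIN M, exists x : M,
      forall y, pcoord N y <-> proj1_sig N (gmul (ginv x) y);
  pcompat : forall N1 N2 : FIN M,
      (forall y, proj1_sig N1 y -> proj1_sig N2 y) ->
      forall y, pcoord N1 y -> pcoord N2 y }.

Lemma pj_coset (M : AbsGroup) (x : M) (N : FIN M) : exists x0 : M,
  forall y, proj1_sig N (gmul (ginv x) y) <-> proj1_sig N (gmul (ginv x0) y).
Proof. by exists x. Qed.

Lemma pj_compat (M : AbsGroup) (x : M) (N1 N2 : FIN M) :
  (forall y, proj1_sig N1 y -> proj1_sig N2 y) ->
  forall y, proj1_sig N1 (gmul (ginv x) y) -> proj1_sig N2 (gmul (ginv x) y).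
Proof. by move=> H y; apply: H. Qed.

Definition pj (M : AbsGroup) (x : M) : profinite_elt M :=
  {| pcoord := fun N y => proj1_sig N (gmul (ginv x) y);
     pcoset := pj_coset x;
     pcompat := @pj_compat M x |}.

(* closure in the (product of discrete) topology: every basic open
   neighbourhood of z -- fixing finitely many coordinates -- meets S *)
Definition pclosure (M : AbsGroup) (S : profinite_elt M -> Prop)
    (z : profinite_elt M) : Prop :=
  forall Ns : list (FIN M), exists s, S s /\
    forall N, List.In N Ns -> forall y, pcoord s N y <-> pcoord z N y.

(* Main.v *)
Require Import Defs.
From HB Require Import structures.
From mathcomp Require Import all_boot all_order all_algebra all_fingroup.
From mathcomp Require Import ssrcomplements mpoly.
From mathcomp Require Import zify ring boolp.
Import GRing.Theory.

Set Implicit Arguments. Unset Strict Implicit. Unset Printing Implicit Defensive.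

(** The easy direction: in a finite quotient of the mapping torus some power of [t] is
trivial, so conjugating by powers of [t] brings [w] to an element [alpha^m w] of [H].

For the converse it suffices to find a finite group and a homomorphism from [F] to it that
separates [alpha^i w] from [H] for all large [i]: the sequence of its compositions with
the iterates of [alpha] is eventually periodic, and one period extends to a finite
quotient of the mapping torus. By M. Hall's theorem there is a finite-index subgroup [K]
of [F] containing [H] and stable under [alpha], such that [H] is carried by a subgraph of
the covering graph of [K]. If no iterate of [w] lies in [K], the action on [F/K]
separates. Otherwise take two labellings of the covering graph by elements of a group that
agree on the subgraph: they define two homomorphisms on [K] that agree on [H], and [alpha]
induces a substitution on the labels. For free labels the two homomorphisms differ at
every element outside [H], so what is needed is the theorem of Borisov and Sapir: a word
that is not killed by the iterates of a substitution survives all of them in a finite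
quotient.

Evaluating words at 2 x 2 matrices, with the adjugate in place of the inverse, turns the
substitution into a polynomial map [Phi] on an affine space of dimension [N] over the
field with [p] elements. For a large power [Q] of [p] consider the ring [R_Q = F_p[x] /
(Phi_i - x_i^Q)], in which [g o Phi = g^Q]. If a polynomial [P] is nilpotent in [R_Q], an
algebraic relation between the [N + 1] polynomials [P], [P o Phi], ..., [P o Phi^N], read
in [R_Q], becomes an equation in [P] alone and gives [(P o Phi^N)^d = 0] in [R_Q] with [d]
independent of [Q]. Polynomials of degree below [Q] are independent in [R_Q], so [P o
Phi^N = 0]. Hence if [P o Phi^N] is not [0], then [P] is a unit in some nonzero finite
quotient of [R_Q], and this quotient gives the finite matrix group. *)

(** * Groups, wreath products and the profinite closure *)

(** The carrier of an [AbsGroup] is a bare type, so finiteness is expressed by an injection into a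
    [finType]. *)
Definition finitely_many (S : Type) := exists (T : finType) (phi : S -> T), injective phi.

Lemma pigeonhole (S : Type) (u : nat -> S) : finitely_many S -> exists i j, (i < j)%N /\ u i = u j.
Proof.
move=> [T [phi phi_inj]]; pose v (i : 'I_#|T|.+1) := phi (u i).
have : ~ injective v by move=> /leq_card; rewrite card_ord ltnn.
move=> Nv; apply: contrapT => Nu; apply: Nv => i j /phi_inj uij.
apply: val_inj; case: (ltngtP i j) => // ij; case: Nu.
  by exists i, j.
by exists j, i.
Qed.

Declare Scope abs_scope.
Delimit Scope abs_scope with A.
Local Open Scope abs_scope.
Notation "x ** y" := (gmul x y) (at level 40, left associativity) : abs_scope.

Section AbsGroupTheory.
Variable G : AbsGroup.
Implicit Types x y z : G.

Lemma gmulgV x : x ** ginv x = gone.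
Proof.
rewrite -[LHS]gmul1 -{1}(gmulV (ginv x)) -gmulA.
by rewrite (gmulA (ginv x)) gmulV gmul1 gmulV.
Qed.

Lemma gmulg1 x : x ** gone = x.
Proof. by rewrite -(gmulV x) gmulA gmulgV gmul1. Qed.

Lemma gmulKV x y : ginv x ** (x ** y) = y.
Proof. by rewrite gmulA gmulV gmul1. Qed.

Lemma gmulVK x y : x ** (ginv x ** y) = y.
Proof. by rewrite gmulA gmulgV gmul1. Qed.

Lemma gmulKr x y : x ** ginv y ** y = x.
Proof. by rewrite -gmulA gmulV gmulg1. Qed.

Lemma gmulI x y z : x ** y = x ** z -> y = z.
Proof. by move=> e; rewrite -(gmulKV x y) e gmulKV. Qed.

Lemma ginv_eq x y : x ** y = gone -> ginv x = y.
Proof. by move=> xy; apply: (@gmulI x); rewrite gmulgV. Qed.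

Lemma ginvK x : ginv (ginv x) = x.
Proof. by apply: ginv_eq; rewrite gmulV. Qed.

Lemma ginvM x y : ginv (x ** y) = ginv y ** ginv x.
Proof. by apply: ginv_eq; rewrite -gmulA gmulVK gmulgV. Qed.

Lemma ginv1 : ginv gone = gone :> G.
Proof. by apply: ginv_eq; rewrite gmul1. Qed.

Lemma gmulV_eq1 x y : ginv x ** y = gone -> x = y.
Proof. by move=> /(congr1 (gmul x)); rewrite gmulVK gmulg1 => ->. Qed.
End AbsGroupTheory.

Section Homs.
Variables (G K : AbsGroup) (phi : G -> K).
Hypothesis phiM : is_hom phi.

Lemma hom1 : phi gone = gone.
Proof. by apply: (@gmulI _ (phi gone)); rewrite -phiM gmul1 gmulg1. Qed.

Lemma homV x : phi (ginv x) = ginv (phi x).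
Proof. by apply/esym/ginv_eq; rewrite -phiM gmulgV hom1. Qed.
End Homs.

Lemma hom_iter (G : AbsGroup) (phi : G -> G) k : is_hom phi -> is_hom (iter k phi).
Proof. by move=> phiM; elim: k => [|k IHk] x y //=; rewrite IHk phiM. Qed.

Lemma sig_eq (T : Type) (P : T -> Prop) (x y : {x | P x}) : proj1_sig x = proj1_sig y -> x = y.
Proof.
by case: x y => [x Px] [y Py] /= xy; case: y / xy Py => Py; rewrite (Prop_irrelevance Px Py).
Qed.

Section Subgroup.
Variables (G : AbsGroup) (P : G -> Prop).
Hypothesis subP : is_subgroup P.

Definition sub_mul (x y : {x | P x}) : {x | P x} :=
  exist _ (proj1_sig x ** proj1_sig y) (subP.2.1 _ _ (proj2_sig x) (proj2_sig y)).
Definition sub_one : {x | P x} := exist _ gone subP.1.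
Definition sub_inv (x : {x | P x}) : {x | P x} :=
  exist _ (ginv (proj1_sig x)) (subP.2.2 _ (proj2_sig x)).

Lemma sub_mulA x y z : sub_mul x (sub_mul y z) = sub_mul (sub_mul x y) z.
Proof. by apply: sig_eq; rewrite /= gmulA. Qed.
Lemma sub_mul1 x : sub_mul sub_one x = x.
Proof. by apply: sig_eq; rewrite /= gmul1. Qed.
Lemma sub_mulV x : sub_mul (sub_inv x) x = sub_one.
Proof. by apply: sig_eq; rewrite /= gmulV. Qed.

Definition sub_group := Build_AbsGroup sub_mulA sub_mul1 sub_mulV.
End Subgroup.

Section FreeGroups.
Variables (F : AbsGroup) (n : nat) (b : 'I_n -> F).
Hypothesis Ffree : is_free_on b.

(** The universal property maps [F] to the subgroup [P]; followed by the inclusion, this map fixes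
    the basis and so is the identity. *)
Lemma free_ind (P : F -> Prop) : is_subgroup P -> (forall i, P (b i)) -> forall x, P x.
Proof.
move=> subP Pb x.
have [[phi [phiM phib]] _] := Ffree (fun i => exist _ (b i) (Pb i) : sub_group subP).
have [_ uniq] := Ffree b.
have -> : x = proj1_sig (phi x); last exact: proj2_sig.
apply: (uniq id (fun x => proj1_sig (phi x))) => // [y z | i].
  by rewrite phiM.
by rewrite phib.
Qed.
End FreeGroups.

Section Words.
Variable I : Type.
Implicit Type u : seq (bool * I).

Definition eval_letter (G : AbsGroup) (A : I -> G) (l : bool * I) :=
  if l.1 then A l.2 else ginv (A l.2).
Definition eval (G : AbsGroup) (A : I -> G) u := foldr (fun l x => eval_letter A l ** x) gone u.

Definition inv_word u := rev [seq (~~ l.1, l.2) | l <- u].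

Lemma eval_cat (G : AbsGroup) (A : I -> G) u u' : eval A (u ++ u') = eval A u ** eval A u'.
Proof. by elim: u => [|l u IHu] /=; rewrite ?gmul1 // IHu gmulA. Qed.

Lemma eval_inv (G : AbsGroup) (A : I -> G) u : eval A (inv_word u) = ginv (eval A u).
Proof.
elim: u => [|l u IHu] /=; first by rewrite ginv1.
rewrite /inv_word /= rev_cons -cats1 eval_cat -/(inv_word u) IHu ginvM /= gmulg1.
by case: l => [[] i]; rewrite /eval_letter /= ?ginvK.
Qed.

End Words.

Lemma free_word (F : AbsGroup) n (b : 'I_n -> F) : is_free_on b -> forall x, exists u, x = eval b u.
Proof.
move=> Ffree; apply: (free_ind Ffree) => [|i]; last first.
  by exists [:: (true, i)]; rewrite /= gmulg1.
split; first by exists [::].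
split=> [x y [u ->] [v ->]|x [u ->]]; first by exists (u ++ v); rewrite eval_cat.
by exists (inv_word u); rewrite eval_inv.
Qed.

Section FinGroup.
Variable gT : finGroupType.
Lemma abs_mulA (x y z : gT) : (x * (y * z) = x * y * z)%g. Proof. exact: mulgA. Qed.
Lemma abs_mul1 (x : gT) : (1 * x = x)%g. Proof. exact: mul1g. Qed.
Lemma abs_mulV (x : gT) : (x^-1 * x = 1)%g. Proof. exact: mulVg. Qed.
Definition abs_group : AbsGroup := Build_AbsGroup abs_mulA abs_mul1 abs_mulV.
End FinGroup.

Section Wreath.
Variables (V : finType) (G : AbsGroup).
Local Notation W := ({perm V} * {ffun V -> G})%type.

(** With this convention a homomorphism to the wreath product is an action on [V] together with a
    cocycle over it. *)
Definition wr_mul (x y : W) : W := ((x.1 * y.1)%g, [ffun v => x.2 v ** y.2 (x.1 v)]).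
Definition wr_one : W := (1%g, [ffun=> gone]).
Definition wr_inv (x : W) : W := ((x.1^-1)%g, [ffun v => ginv (x.2 ((x.1^-1)%g v))]).

Lemma wr_mulA x y z : wr_mul x (wr_mul y z) = wr_mul (wr_mul x y) z.
Proof.
congr pair; first by rewrite /= mulgA.
by apply/ffunP => v; rewrite !ffunE /= permM gmulA.
Qed.

Lemma wr_mul1 x : wr_mul wr_one x = x.
Proof.
case: x => s a; congr pair; first by rewrite /= mul1g.
by apply/ffunP => v; rewrite !ffunE perm1 gmul1.
Qed.

Lemma wr_mulV x : wr_mul (wr_inv x) x = wr_one.
Proof.
congr pair; first by rewrite /= mulVg.
by apply/ffunP => v; rewrite !ffunE gmulV.
Qed.

Definition wreath : AbsGroup := Build_AbsGroup wr_mulA wr_mul1 wr_mulV.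

Lemma finitely_many_wreath : finitely_many G -> finitely_many wreath.
Proof.
move=> [T [phi phi_inj]].
exists ({perm V} * {ffun V -> T})%type, (fun x : W => (x.1, [ffun v => phi (x.2 v)])).
move=> [s a] [s' a'] [-> /ffunP eqa]; congr pair; apply/ffunP => v; apply: phi_inj.
by have := eqa v; rewrite !ffunE.
Qed.
End Wreath.

Section ProductGroup.
Variables (G K : AbsGroup).
Definition pair_mul (x y : G * K) : G * K := (x.1 ** y.1, x.2 ** y.2).
Lemma pair_mulA x y z : pair_mul x (pair_mul y z) = pair_mul (pair_mul x y) z.
Proof. by rewrite /pair_mul /= !gmulA. Qed.
Lemma pair_mul1 x : pair_mul (gone, gone) x = x.
Proof. by case: x => x y; rewrite /pair_mul /= !gmul1. Qed.
Lemma pair_mulV x : pair_mul (ginv x.1, ginv x.2) x = (gone, gone).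
Proof. by rewrite /pair_mul /= !gmulV. Qed.
Definition pair_group : AbsGroup := Build_AbsGroup pair_mulA pair_mul1 pair_mulV.

Lemma finitely_many_pair : finitely_many G -> finitely_many K -> finitely_many pair_group.
Proof.
move=> [T [phi phi_inj]] [T' [phi' phi'_inj]].
exists (T * T')%type, (fun x : G * K => (phi x.1, phi' x.2)).
by move=> [x y] [x' y'] [/phi_inj /= -> /phi'_inj /= ->].
Qed.
End ProductGroup.

Lemma kernel_fin_index (M G : AbsGroup) (phi : M -> G) :
  is_hom phi -> finitely_many G -> fin_index_normal (fun x => phi x = gone).
Proof.
move=> phiM [T [tau tau_inj]]; split; last split.
- split; first exact: hom1.
  by split=> [x y|x]; rewrite ?phiM ?homV // => ->; rewrite ?gmul1 ?ginv1.
- by move=> x y yN; rewrite !phiM homV // yN gmul1 gmulgV.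
(* One preimage for each attained element of [T]; the default [gone] is met only at elements that
   are not attained. *)
pose r (i : 'I_#|T|) :=
  if pselect (exists x, tau (phi x) = enum_val i) is left e then projT1 (cid e) else gone.
exists #|T|, r => x; exists (enum_rank (tau (phi x))); rewrite /r.
case: pselect => [e|[]]; last by exists x; rewrite enum_rankK.
case: (cid e) => y /=; rewrite enum_rankK => /tau_inj eqxy.
by rewrite phiM homV // eqxy gmulV.
Qed.

(** * Closure of [H] in the profinite completion of the mapping torus *)

Section Closure.
Variables (F : AbsGroup) (n : nat) (b : 'I_n -> F) (alpha : F -> F)
  (M : AbsGroup) (kappa : F -> M) (t : M) (H : F -> Prop).
Hypotheses (Ffree : is_free_on b) (alphaM : is_hom alpha)
  (torus : is_mapping_torus alpha kappa t) (Halpha : forall h, H h -> H (alpha h)).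

Local Notation closed_under w :=
  (pclosure (fun z => exists h, H h /\ z = pj (kappa h)) (pj (kappa w))).

Lemma iter_sub k h : H h -> H (iter k alpha h).
Proof. by move=> Hh; elim: k => //= k; apply: Halpha. Qed.

Fixpoint gexp (x : M) k := if k is k'.+1 then x ** gexp x k' else gone.

Lemma gexpD x k l : gexp x (k + l) = gexp x k ** gexp x l.
Proof. by elim: k => [|k IHk]; rewrite ?gmul1 // addSn /= IHk gmulA. Qed.

Lemma torus_iter k f : kappa f ** gexp t k = gexp t k ** kappa (iter k alpha f).
Proof.
have [_ [tconj _]] := torus.
elim: k => [|k IHk]; first by rewrite /= gmulg1 gmul1.
have -> : gexp t k.+1 = gexp t k ** t by rewrite -addn1 gexpD /= gmulg1.
by rewrite gmulA IHk -!gmulA iterS -tconj gmulVK.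
Qed.

Lemma fin_index_exp (N : M -> Prop) x : fin_index_normal N -> exists2 k, (0 < k)%N & N (gexp x k).
Proof.
move=> [[N1 [NM NV]] [_ [k [r rP]]]].
have [rep repP] := choice (fun i => rP (gexp x i)).
have fin : finitely_many 'I_k by exists 'I_k, id.
have [i [j [ij eqij]]] := pigeonhole rep fin.
exists (j - i)%N; first by rewrite subn_gt0.
have -> : gexp x (j - i) = ginv (ginv (r (rep i)) ** gexp x i) ** (ginv (r (rep j)) ** gexp x j).
  by rewrite eqij ginvM ginvK -gmulA gmulVK -{2}(subnKC (ltnW ij)) gexpD gmulKV.
by apply: NM; [apply: NV|]; apply: repP.
Qed.

Lemma gexpM (N : M -> Prop) x k l : is_subgroup N -> N (gexp x k) -> N (gexp x (l * k)).
Proof.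
move=> [N1 [NM NV]] Nk; elim: l => [|l IHl] //.
by rewrite mulSn gexpD; apply: NM.
Qed.

Lemma fin_index_exp_list (Ns : list (FIN M)) x : exists2 k, (0 < k)%N &
  forall N : FIN M, List.In N Ns -> proj1_sig N (gexp x k).
Proof.
elim: Ns => [|N Ns [k k0 IHk]]; first by exists 1%N.
have [l l0 Nl] := fin_index_exp x (proj2_sig N).
exists (k * l)%N; first by rewrite muln_gt0 k0.
move=> N' [<-|N'in]; first by apply: gexpM => //; case: (proj2_sig N).
by rewrite mulnC; apply: gexpM; [case: (proj2_sig N') | apply: IHk].
Qed.

(** Some [t ^ (k * l)] with [l > 0] lies in all the given normal subgroups, so [w] is congruent to
    [alpha^(k * l) w], which is in [H] because [k <= k * l]. *)
Lemma closure_of_iter w : (exists k, H (iter k alpha w)) -> closed_under w.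
Proof.
move=> [k Hk] Ns.
have [l l0 Nl] := fin_index_exp_list Ns t.
pose m := (k * l - k)%N.
have kl : (k * l = k + m)%N by rewrite subnKC // leq_pmulr.
exists (pj (kappa (iter m alpha (iter k alpha w)))); split.
  by exists (iter m alpha (iter k alpha w)); split=> //; apply: iter_sub.
move=> N NNs y /=.
have [[N1 [NM NV]] [Nnorm _]] := proj2_sig N.
have Nkl : proj1_sig N (gexp t (k * l)).
  by apply: gexpM; [case: (proj2_sig N) | apply: Nl].
have := torus_iter (k * l) w; rewrite [in iter _ _ _]kl addnC iterD.
set h := iter m _ _; set T := gexp t _ => eqh.
have Nwh : proj1_sig N (ginv (kappa w) ** kappa h).
  have -> : ginv (kappa w) ** kappa h = ginv (kappa w) ** (ginv T ** (kappa w)) ** T.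
    by rewrite -!gmulA eqh gmulKV.
  apply: (NM) => //.
  by have := Nnorm (ginv (kappa w)) _ (NV _ Nkl); rewrite ginvK.
split=> Ny.
  have -> : ginv (kappa w) ** y = (ginv (kappa w) ** kappa h) ** (ginv (kappa h) ** y).
    by rewrite -gmulA gmulVK.
  exact: NM.
have -> : ginv (kappa h) ** y = ginv (ginv (kappa w) ** kappa h) ** (ginv (kappa w) ** y).
  by rewrite ginvM ginvK -gmulA gmulVK.
by apply: NM => //; apply: NV.
Qed.

(** [rho \o alpha^k] is determined by its values on the basis, so only finitely many such maps
    exist. *)
Lemma hom_iter_periodic (G : AbsGroup) (rho : F -> G) i0 : is_hom rho -> finitely_many G ->
  exists i j, [/\ (i0 <= i)%N, (i < j)%N & forall x, rho (iter i alpha x) = rho (iter j alpha x)].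
Proof.
move=> rhoM [T [tau tau_inj]].
pose u k := [ffun l : 'I_n => tau (rho (iter (i0 + k) alpha (b l)))].
have fin : finitely_many {ffun 'I_n -> T} by exists {ffun 'I_n -> T}, id.
have [i [j [ij /ffunP eqij]]] := pigeonhole u fin.
exists (i0 + i)%N, (i0 + j)%N; split; rewrite ?leq_addr ?ltn_add2l //.
have [_ uniq] := Ffree (fun l => rho (b l)).
apply: (uniq _ (fun x => rho (iter _ alpha x))); try by move=> x y; rewrite hom_iter // rhoM.
by move=> l; apply: tau_inj; have := eqij l; rewrite !ffunE.
Qed.

(** The maps [rho \o alpha^(i + v)] over one period are the coordinates of a map [psi] to the wreath
    product. There [alpha] becomes a cyclic shift of coordinates, and this shift is the image of
    [t]. *)
Lemma not_closure (G : AbsGroup) (rho : F -> G) i0 w : is_hom rho -> finitely_many G ->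
  (forall i h, (i0 <= i)%N -> H h -> rho (iter i alpha w) <> rho h) -> ~ closed_under w.
Proof.
move=> rhoM finG sep.
have [i [j [i0i ij per]]] := hom_iter_periodic i0 rhoM finG.
have [_ [_ [univ _]]] := torus.
pose p := (j - i)%N; have p0 : (0 < p)%N by rewrite subn_gt0.
pose psi f : wreath 'I_p G := (1%g, [ffun v : 'I_p => rho (iter (i + v) alpha f)]).
pose shift : {perm 'I_p} := perm (@ordS_inj p).
pose g : wreath 'I_p G := ((shift^-1)%g, [ffun=> gone]).
have psiM : is_hom psi.
  move=> x y; congr pair; first by rewrite /= mulg1.
  by apply/ffunP => v; rewrite !ffunE perm1 hom_iter // rhoM.
have gpsi f : ginv g ** (psi f ** g) = psi (alpha f).
  congr pair; first by rewrite /= mul1g mulVg.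
  apply/ffunP => v; rewrite !ffunE /= invgK ?permE ginv1 gmul1 gmulg1 -iterSr -addnS.
  have [vp|pv] := ltnP v.+1 p; first by rewrite /= modn_small.
  have vS : v.+1 = p by apply/eqP; rewrite eqn_leq ltn_ord.
  rewrite vS.
  by rewrite /= [in LHS]vS modnn addn0 per subnKC // ltnW.
have [phi [phiM [phik phit]]] := univ _ psi g psiM gpsi.
pose N : FIN M := exist _ _ (kernel_fin_index phiM (finitely_many_wreath _ finG)).
move=> /(_ [:: N]) [_ [[h [Hh ->]] /(_ N)]] => /(_ (or_introl erefl) (kappa w)) /=.
rewrite gmulV hom1 // => -[_ /(_ erefl)].
rewrite phiM homV // !phik => eq1.
(* Coordinate 0 compares [alpha^i w] with [alpha^i h], which is again in [H]. *)
have /(congr1 snd) /ffunP /(_ (Ordinal p0)) := gmulV_eq1 (eq1 : ginv (psi h) ** psi w = gone).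
rewrite !ffunE /= addn0 => /esym.
by apply: sep => //; apply: iter_sub.
Qed.

(** Conjugation by [t ^ k] induces [alpha^k] on [F] and preserves every normal subgroup, so it
    carries approximations of [w] to approximations of [alpha^k w]. *)
Lemma closure_iter k w : closed_under w -> closed_under (iter k alpha w).
Proof.
move=> clw Ns; have [_ [[h [Hh ->]] hP]] := clw Ns.
exists (pj (kappa (iter k alpha h))); split.
  by exists (iter k alpha h); split=> //; apply: iter_sub.
move=> N NNs y /=.
have [_ [Nnorm _]] := proj2_sig N.
have conj f : ginv (kappa (iter k alpha f)) ** y =
    ginv (gexp t k) ** (ginv (kappa f) ** (gexp t k ** y ** ginv (gexp t k)) ** ginv (ginv (gexp t k))).
  have -> : kappa (iter k alpha f) = ginv (gexp t k) ** (kappa f ** gexp t k).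
    by rewrite torus_iter gmulKV.
  by rewrite !ginvM ginvK -!gmulA gmulV gmulg1.
rewrite !conj; have Nh := hP N NNs (gexp t k ** y ** ginv (gexp t k)); move: Nh => /= Nh.
have back z : proj1_sig N (ginv (gexp t k) ** (z ** ginv (ginv (gexp t k)))) -> proj1_sig N z.
  by move=> /(Nnorm (gexp t k)); rewrite ginvK -!gmulA gmulVK gmulgV gmulg1.
by split=> /back Ny; apply: (Nnorm); apply/Nh.
Qed.
End Closure.

(** * A finite cover adapted to [H], and its double *)

(** Extend [f] from [A] minus a point [a], then compose with the transposition of [s a] and [f a],
    which moves none of the other values of [f] on [A]. *)
Lemma extend_partial_injection (T : finType) (A : {set T}) (f : T -> T) :
  {in A &, injective f} -> exists s : {perm T}, {in A, s =1 f}.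
Proof.
have [k] := ubnP #|A|; elim: k A => // k IHk A; rewrite ltnS => Ak f_inj.
have [->|[a aA]] := set_0Vmem A; first by exists 1%g => x; rewrite inE.
have [||s sf] := IHk (A :\ a).
- by apply: leq_trans Ak; rewrite [ltnRHS](cardsD1 a) aA.
- by apply: sub_in2 f_inj => x; rewrite inE => /andP[].
exists (s * tperm (s a) (f a))%g => x xA; rewrite permM.
have [->|xa] := eqVneq x a; first by rewrite tpermL.
have sx : s x = f x by rewrite sf // !inE xa.
rewrite tpermD ?(inj_eq perm_inj) 1?eq_sym // sx.
by apply: contraNneq xa => /f_inj ->.
Qed.

(** * Cocycles over a permutation action of a free group *)

Section Cocycles.
Variables (F : AbsGroup) (n : nat) (b : 'I_n -> F) (V : finType) (act : F -> {perm V}).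
Hypotheses (Ffree : is_free_on b) (actM : is_hom (act : F -> abs_group {perm V})).

Lemma actD x y v : act (x ** y) v = act y (act x v).
Proof. by rewrite actM permM. Qed.

Lemma act1 v : act gone v = v.
Proof. by rewrite (hom1 actM) perm1. Qed.

Lemma actV x : act (ginv x) = (act x)^-1%g.
Proof. by rewrite (homV actM). Qed.

Section Labels.
Variables (G : AbsGroup) (A : V * 'I_n -> G).

Lemma wreath_hom_exists : exists chi : F -> wreath V G,
  is_hom chi /\ forall i, chi (b i) = (act (b i), [ffun v => A (v, i)]).
Proof.
by have [] := Ffree (fun i => (act (b i), [ffun v => A (v, i)]) : wreath V G).
Qed.

Definition wreath_hom : F -> wreath V G := projT1 (cid wreath_hom_exists).

Lemma wreath_homM : is_hom wreath_hom.
Proof. by rewrite /wreath_hom; case: (cid _) => chi []. Qed.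

Lemma wreath_hom_gen i : wreath_hom (b i) = (act (b i), [ffun v => A (v, i)]).
Proof. by rewrite /wreath_hom; case: (cid _) => chi []. Qed.

Lemma wreath_hom1 x : (wreath_hom x).1 = act x.
Proof.
have [_ uniq] := Ffree (fun i => act (b i) : abs_group {perm V}).
apply: (uniq (fun x => (wreath_hom x).1) act) => // [y z|i].
  by rewrite wreath_homM.
by rewrite wreath_hom_gen.
Qed.

(** The product of the labels along the path that [x] traces from [v] in the graph of the action. *)
Definition cocycle x v : G := (wreath_hom x).2 v.

Lemma cocycleM x y v : cocycle (x ** y) v = cocycle x v ** cocycle y (act x v).
Proof. by rewrite /cocycle wreath_homM ffunE wreath_hom1. Qed.

Lemma cocycle_gen i v : cocycle (b i) v = A (v, i).
Proof. by rewrite /cocycle wreath_hom_gen ffunE. Qed.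

Lemma cocycle1 v : cocycle gone v = gone.
Proof. by rewrite /cocycle (hom1 wreath_homM) ffunE. Qed.

Lemma cocycleV x v : cocycle (ginv x) v = ginv (cocycle x (act (ginv x) v)).
Proof.
apply/esym/ginv_eq; have := cocycleM x (ginv x) (act (ginv x) v).
by rewrite gmulgV cocycle1 -actD gmulV act1.
Qed.
End Labels.

(** The restriction to an invariant set [O] serves [pull_labelP], where one of the two maps is a
    cocycle on the orbit of [v0]. *)
Lemma cocycle_uniq (G : AbsGroup) (O : V -> Prop) (C D : F -> V -> G) :
  (forall x v, O v -> O (act x v)) ->
  (forall x y v, O v -> C (x ** y) v = C x v ** C y (act x v)) ->
  (forall x y v, O v -> D (x ** y) v = D x v ** D y (act x v)) ->
  (forall i v, O v -> C (b i) v = D (b i) v) ->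
  forall x v, O v -> C x v = D x v.
Proof.
move=> Oact CM DM CD.
have one E v : (forall x y v, O v -> E (x ** y) v = E x v ** E y (act x v)) ->
    O v -> E gone v = gone :> G.
  move=> EM Ov; apply: (@gmulI _ (E gone v)).
  by have := EM gone gone v Ov; rewrite gmul1 act1 gmulg1 => {1}<-.
apply: (free_ind Ffree) => [|i v]; last exact: CD.
split; first by move=> v Ov; rewrite !one.
split=> [x y Cx Cy v Ov|x Cx v Ov]; first by rewrite CM // DM // Cx // Cy //; apply: Oact.
apply: (@gmulI _ (C x (act (ginv x) v))).
have Ov' := Oact (ginv x) v Ov.
have back : act x (act (ginv x) v) = v by rewrite -actD gmulV act1.
have := CM x (ginv x) _ Ov'; have := DM x (ginv x) _ Ov'.
by rewrite !back !gmulgV !one // Cx // => <- <-.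
Qed.

(** Edges are named by their origin, so an inverse letter read at [v] traverses backwards the edge
    that ends at [v]. *)
Fixpoint path_word v (u : seq (bool * 'I_n)) : seq (bool * (V * 'I_n)) :=
  match u with
  | [::] => [::]
  | (true, i) :: u' => (true, (v, i)) :: path_word (act (b i) v) u'
  | (false, i) :: u' =>
      (false, (act (ginv (b i)) v, i)) :: path_word (act (ginv (b i)) v) u'
  end.

Lemma eval_path_word (G : AbsGroup) (A : V * 'I_n -> G) u v :
  cocycle A (eval b u) v = eval A (path_word v u).
Proof.
elim: u v => [|[[] i] u IHu] v /=; first by rewrite cocycle1.
  by rewrite cocycleM cocycle_gen IHu.
by rewrite cocycleM cocycleV cocycle_gen IHu.
Qed.
End Cocycles.

(* M. Hall's theorem: on a finite set of cosets of [H] every generator acts by a partial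
   injection, and these extend to permutations. *)
Section Hall.
Variables (F : AbsGroup) (n : nat) (b : 'I_n -> F) (H : F -> Prop).
Hypotheses (Ffree : is_free_on b) (subH : is_subgroup H).
Variables (I : finType) (X : I -> F).

Definition same_coset x y := H (x ** ginv y).
Definition near x := exists p, same_coset x (X p).

Lemma same_cosetxx x : same_coset x x.
Proof. by rewrite /same_coset gmulgV; apply: subH.1. Qed.

Lemma same_coset_sym x y : same_coset x y -> same_coset y x.
Proof. by move=> /subH.2.2; rewrite ginvM ginvK. Qed.

Lemma same_coset_trans x y z : same_coset x y -> same_coset y z -> same_coset x z.
Proof. by move=> xy yz; have := subH.2.1 _ _ xy yz; rewrite -!gmulA gmulKV. Qed.

Lemma same_cosetM x y z : same_coset (x ** z) (y ** z) <-> same_coset x y.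
Proof. by rewrite /same_coset ginvM -gmulA gmulVK. Qed.

(** Several [p] may represent one coset; picking one of them gives the coset a unique name. [None]
    stands for all cosets not represented by [X]. *)
Definition coset_index x : option I := [pick p | `[< same_coset x (X p) >]].

Lemma coset_index_same x y : same_coset x y -> coset_index x = coset_index y.
Proof.
move=> xy; apply: eq_pick => p; apply/asboolP/asboolP; last exact: same_coset_trans.
exact/same_coset_trans/same_coset_sym.
Qed.

Lemma coset_index_inj x y : near x -> coset_index x = coset_index y -> same_coset x y.
Proof.
move=> [p xp]; rewrite /coset_index.
case: pickP => [q /asboolP xq|/(_ p) /asboolP//].
case: pickP => // r /asboolP yr [qr]; apply: same_coset_trans xq _.
by rewrite qr; apply: same_coset_sym.
Qed.

Lemma coset_action : exists rho : F -> abs_group {perm (option I)}, is_hom rho /\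
  forall x i, near x -> near (x ** b i) -> rho (b i) (coset_index x) = coset_index (x ** b i).
Proof.
suff step i : exists s : {perm option I}, forall x, near x -> near (x ** b i) ->
    s (coset_index x) = coset_index (x ** b i).
  have [s sP] := choice step.
  have [[rho [rhoM rhob]] _] := Ffree (s : _ -> abs_group {perm (option I)}).
  by exists rho; split=> // x i; rewrite rhob; apply: sP.
pose P t x := [/\ near x, near (x ** b i) & coset_index x = t].
pose A := [set t | `[< exists x, P t x >]].
pose f t := if pselect (exists x, P t x) is left e then coset_index (projT1 (cid e) ** b i) else t.
have fP t : t \in A -> exists2 x, P t x & f t = coset_index (x ** b i).
  rewrite inE => /asboolP e; rewrite /f; case: pselect => // e'.
  by case: (cid e') => x Px; exists x.
have [s sf] : exists s : {perm option I}, {in A, s =1 f}.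
  apply: extend_partial_injection => t t' /fP [x [nx nxb <-] ->] /fP [y [ny nyb <-] ->].
  by move/(coset_index_inj nxb)/same_cosetM/coset_index_same.
exists s => x nx nxb; have xA : coset_index x \in A by rewrite inE; apply/asboolP; exists x.
rewrite sf //; have [y [ny _ eqyx] ->] := fP _ xA.
by apply/coset_index_same/same_cosetM/coset_index_inj.
Qed.
End Hall.

Section Cover.
Variables (F : AbsGroup) (n : nat) (b : 'I_n -> F) (alpha : F -> F) (H : F -> Prop)
  (k : nat) (s : 'I_k -> F).
Hypotheses (Ffree : is_free_on b) (alphaM : is_hom alpha) (subH : is_subgroup H)
  (Hs : forall x, H x <-> gen_by s x) (Halpha : forall h, H h -> H (alpha h)).

Lemma gen_subgroup i : H (s i).
Proof. by apply/Hs => K _; apply. Qed.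

Lemma gen_subgroup_ind (P : F -> Prop) : is_subgroup P -> (forall i, P (s i)) -> forall h, H h -> P h.
Proof. by move=> subP Ps h /Hs; apply. Qed.

Lemma stabilizer_subgroup (V : finType) (act : F -> abs_group {perm V}) v :
  is_hom act -> is_subgroup (fun x => act x v = v).
Proof.
move=> actM; split; first by rewrite (hom1 actM) perm1.
split=> [x y xv yv|x xv]; first by rewrite actM permM xv.
by rewrite (homV actM) -{1}xv permK.
Qed.

(* [V] contains the cosets of a finite-index subgroup, the stabilizer of [v0]; on the vertices
   that the generators of [H] visit, the transversal [tau] picks a representative of the right
   coset of [H], which is why the loops in the last clause lie in [H]. *)
Lemma stable_cover : exists (V : finType) (act : F -> abs_group {perm V}) (v0 : V) (tau : V -> F),
  [/\ is_hom act, forall h, H h -> act h v0 = v0 &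
      forall x, act x v0 = v0 -> act (alpha x) v0 = v0] /\
  [/\ tau v0 = gone, forall x, act (tau (act x v0)) v0 = act x v0 &
      forall j, exists2 u, s j = eval b u &
        forall l, l \in path_word b act v0 u ->
          H (tau l.2.1 ** b l.2.2 ** ginv (tau (act (b l.2.2) l.2.1)))].
Proof.
have [u uP] := choice (fun j => free_word Ffree (s j)).
(* All prefixes of the words for the generators of [H], so that the path of each generator stays
   among the chosen cosets; [None] provides the coset of [gone]. *)
pose I := option {j : 'I_k & 'I_(size (u j)).+1}.
pose X (p : I) := if p is Some q then eval b (take (tagged q) (u (tag q))) else gone.
have [rho [rhoM rhoP]] := coset_action Ffree subH X.
pose c := coset_index H X; pose T := option I.
have near_take j m : near H X (eval b (take m (u j))).
  have [mu|um] := leqP m (size (u j)).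
    exists (Some (existT _ j (Ordinal (mu : m < (size (u j)).+1)))).
    exact: same_cosetxx.
  exists (Some (existT _ j ord_max)).
  by rewrite /X /= take_size take_oversize ?(ltnW um) //; apply: same_cosetxx.
have near1 : near H X gone by exists None; apply: same_cosetxx.
(* The permutations extend the coset action arbitrarily; [x] is good when the vertex it reaches from
   the base is truly its own coset. *)
pose good x := near H X x /\ rho x (c gone) = c x.
have good1 : good gone by split=> //; rewrite (hom1 rhoM) perm1.
have good_step x i : good x -> near H X (x ** b i) -> good (x ** b i).
  by move=> [nx gx] nxb; split=> //; rewrite rhoM permM gx; apply: rhoP.
have good_back x i : good x -> near H X (x ** ginv (b i)) -> good (x ** ginv (b i)).
  move=> [nx gx] nxb; split=> //; rewrite rhoM permM gx (homV rhoM).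
  apply: (canLR (permK _)); rewrite rhoP ?gmulKr //.
have good_path (v : seq (bool * 'I_n)) x :
    good x -> (forall m, near H X (x ** eval b (take m v))) -> good (x ** eval b v).
  elim: v x => [|[[] i] v IHv] x gx nv; first by rewrite gmulg1.
    rewrite /= gmulA; apply: IHv => [|m]; last by have := nv m.+1; rewrite /= gmulA.
    by apply: good_step => //; have := nv 1%N; rewrite /= take0 /= gmulg1.
  rewrite /= gmulA; apply: IHv => [|m]; last by have := nv m.+1; rewrite /= gmulA.
  by apply: good_back => //; have := nv 1%N; rewrite /= take0 /= gmulg1.
have rhoH h : H h -> rho h (c gone) = c gone.
  apply: (gen_subgroup_ind (P := fun h => rho h (c gone) = c gone)).
    exact: stabilizer_subgroup.
  move=> j; have [] : good (s j).
    by rewrite uP -[eval _ _]gmul1; apply: good_path => // m; rewrite gmul1; apply: near_take.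
  move=> _ ->; apply/coset_index_same => //.
  by rewrite /same_coset ginv1 gmulg1; apply: gen_subgroup.
have [i0 [r [_ i0r per]]] : exists i j,
    [/\ 0 <= i, i < j & forall x, rho (iter i alpha x) = rho (iter j alpha x)].
  by apply: hom_iter_periodic => //; exists {perm T}, id.
have r0 : 0 < r by apply: leq_ltn_trans i0r.
(* [r] copies of the action, twisted by the iterates of [alpha]: fixing [v0] means that [alpha^i x]
   fixes the base for all [i < r]. This is stable under [alpha] because [rho \o alpha^r] repeats an
   earlier map. *)
pose V := {ffun 'I_r -> T}.
have move_inj x : injective (fun v : V => [ffun i : 'I_r => rho (iter i alpha x) (v i)]).
  move=> v v' /ffunP eqv; apply/ffunP => i; apply: (@perm_inj _ (rho (iter i alpha x))).
  by have := eqv i; rewrite !ffunE.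
pose act x : abs_group {perm V} := perm (@move_inj x).
pose v0 : V := [ffun=> c gone].
have actM : is_hom act.
  move=> x y; apply/permP => v; rewrite permM !permE; apply/ffunP => i.
  by rewrite !ffunE hom_iter // rhoM permM.
have act0 x y : act x v0 = act y v0 -> rho x (c gone) = rho y (c gone).
  by rewrite !permE => /ffunP /(_ (Ordinal r0)); rewrite !ffunE.
pose tau v := if v == v0 then gone else
  if pselect (exists x, good x /\ act x v0 = v) is left e then projT1 (cid e) else
  if pselect (exists x, act x v0 = v) is left e then projT1 (cid e) else gone.
have tau0 : tau v0 = gone by rewrite /tau eqxx.
have tauP x : act (tau (act x v0)) v0 = act x v0.
  rewrite /tau; case: eqP => [->|_]; first by rewrite (hom1 actM) perm1.
  case: pselect => [e|_]; first by case: (cid e) => y [].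
  by case: pselect => [e|[]]; [case: (cid e) | exists x].
have tau_good x : good x -> same_coset H (tau (act x v0)) x.
  move=> gx; have good_eq y : good y -> act y v0 = act x v0 -> same_coset H y x.
    move=> [ny gy] /act0; rewrite gy gx.2; exact: coset_index_inj.
  rewrite /tau; case: eqP => [e|_].
    by apply: good_eq => //; rewrite e (hom1 actM) perm1.
  by case: pselect => [e|[]]; [case: (cid e) => y [gy yx]; apply: good_eq | exists x].
have edge_good x i : good x -> good (x ** b i) ->
    H (tau (act x v0) ** b i ** ginv (tau (act (b i) (act x v0)))).
  move=> gx gxb; rewrite -(actD actM).
  apply: same_coset_trans (same_coset_sym subH (tau_good _ gxb)) => //.
  by apply/same_cosetM; apply: tau_good.
exists V, act, v0, tau; split; split=> //.
- move=> h Hh; rewrite permE; apply/ffunP => i; rewrite !ffunE; apply: rhoH.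
  exact: iter_sub.
- move=> x; rewrite !permE => /ffunP xv0; apply/ffunP => i; rewrite !ffunE -iterSr.
  have fixed (m : 'I_r) : rho (iter m alpha x) (c gone) = c gone.
    by have := xv0 m; rewrite !ffunE.
  have [ir|ri] := ltnP i.+1 r; first exact: (fixed (Ordinal ir)).
  have -> : i.+1 = r by apply/eqP; rewrite eqn_leq ltn_ord.
  by rewrite -per; apply: (fixed (Ordinal i0r)).
move=> j; exists (u j) => //.
have : forall m, near H X (gone ** eval b (take m (u j))) by move=> m; rewrite gmul1.
(* The base point is generalized to the endpoint of any good prefix, for the induction on the rest
   of the word. *)
have -> : v0 = act gone v0 by rewrite (hom1 actM) perm1.
elim: (u j) gone good1 => [|[[] i] v IHv] x gx nv l //=; rewrite inE.
  have gxb : good (x ** b i).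
    by apply: good_step => //; have := nv 1%N; rewrite /= take0 /= gmulg1.
  case/predU1P => [->|]; first exact: edge_good.
  rewrite -(actD actM); apply: IHv => // m.
  by have := nv m.+1; rewrite /= gmulA.
have gxb : good (x ** ginv (b i)).
  by apply: good_back => //; have := nv 1%N; rewrite /= take0 /= gmulg1.
rewrite -(actD actM) => /predU1P [->|] /=; first by apply: edge_good => //; rewrite gmulKr.
by apply: IHv => // m; have := nv m.+1; rewrite /= gmulA.
Qed.
End Cover.

(** * Two labellings of the cover that agree along [H] *)

Section Doubling.
Variables (F : AbsGroup) (n : nat) (b : 'I_n -> F) (alpha : F -> F) (H : F -> Prop)
  (k : nat) (s : 'I_k -> F).
Hypotheses (Ffree : is_free_on b) (alphaM : is_hom alpha) (subH : is_subgroup H)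
  (Hs : forall x, H x <-> gen_by s x) (Halpha : forall h, H h -> H (alpha h)).
Variables (V : finType) (act : F -> abs_group {perm V}) (v0 : V) (tau : V -> F).
Hypotheses (actM : is_hom act) (Hfix : forall h, H h -> act h v0 = v0)
  (stab_alpha : forall x, act x v0 = v0 -> act (alpha x) v0 = v0).
Hypotheses (tau0 : tau v0 = gone) (tauP : forall x, act (tau (act x v0)) v0 = act x v0).

(** The Schreier generator attached to an edge [e]: it fixes [v0] when [e] starts in the orbit of
    [v0]. *)
Definition edge_loop (e : V * 'I_n) := tau e.1 ** b e.2 ** ginv (tau (act (b e.2) e.1)).

Hypothesis Hpath : forall j, exists2 u, s j = eval b u &
  forall l, l \in path_word b act v0 u -> H (edge_loop l.2).

Definition shared (e : V * 'I_n) := `[< H (edge_loop e) >].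
(** A shared edge gets the index [false] in both copies, so a single label serves both. *)
Definition variant (c : bool) (e : V * 'I_n) := (c && ~~ shared e, e).

Section Labels.
Variables (G : AbsGroup) (A : bool * (V * 'I_n) -> G).

(* The two labellings of the covering graph share the labels of the edges whose loop lies in [H]. *)
Definition double_cocycle (c : bool) := cocycle act Ffree (A \o variant c).

(** The path of a generator of [H] uses shared edges only. The induction also carries
    [act h v0 = v0], which makes both cocycles multiplicative at [v0]. *)
Lemma double_cocycle_sub h : H h -> double_cocycle true h v0 = double_cocycle false h v0.
Proof.
move=> Hh.
suff [] : act h v0 = v0 /\ double_cocycle true h v0 = double_cocycle false h v0 by [].
apply: (gen_subgroup_ind Hs (P := fun h => act h v0 = v0 /\
  double_cocycle true h v0 = double_cocycle false h v0)) => //.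
  split; first by rewrite /double_cocycle !cocycle1 // (hom1 actM) perm1.
  split=> [x y [xv eqx] [yv eqy]|x [xv eqx]].
    by rewrite (actD actM) xv yv /double_cocycle !cocycleM // xv -!/(double_cocycle _) eqx eqy.
  have xv' : act (ginv x) v0 = v0 by rewrite (actV actM) -{1}xv permK.
  by rewrite xv' /double_cocycle !cocycleV // xv' -!/(double_cocycle _) eqx.
move=> j; split; first by apply/Hfix/(gen_subgroup Hs).
have [u -> uP] := Hpath j.
rewrite /double_cocycle !eval_path_word //.
elim: (path_word _ _ _ _) uP => //= l v IHv uP.
rewrite IHv => [|l' l'v]; last by apply: uP; rewrite inE l'v orbT.
congr (_ ** _); rewrite /eval_letter /= /variant /shared.
by have /asboolP -> := uP l (mem_head _ _).
Qed.

Definition pull_label (e : bool * (V * 'I_n)) : G := double_cocycle e.1 (alpha (edge_loop e.2)) v0.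

Lemma double_cocycleM c x y v :
  double_cocycle c (x ** y) v = double_cocycle c x v ** double_cocycle c y (act x v).
Proof. exact: cocycleM. Qed.
End Labels.

(** Correcting by the transversal turns the values at [alpha x] into a cocycle [D] on the orbit of
    [v0], whose labels on the generators are those of [pull_label]. *)
Lemma pull_labelP (G : AbsGroup) (A : bool * (V * 'I_n) -> G) c x : act x v0 = v0 ->
  double_cocycle (pull_label A) c x v0 = double_cocycle A c (alpha x) v0.
Proof.
move=> xv0; pose O v := exists y, v = act y v0.
pose D x v := double_cocycle A c (alpha (tau v ** x ** ginv (tau (act x v)))) v0.
have -> : double_cocycle A c (alpha x) v0 = D x v0.
  by rewrite /D xv0 tau0 ginv1 gmulg1 gmul1.
apply: (cocycle_uniq Ffree actM (O := O)).
- by move=> y v [z ->]; exists (z ** y); rewrite (actD actM).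
- by move=> y z v _; apply: cocycleM.
- move=> y z v [w ->]; rewrite /D.
  have -> : tau (act w v0) ** (y ** z) ** ginv (tau (act (y ** z) (act w v0))) =
     (tau (act w v0) ** y ** ginv (tau (act y (act w v0)))) **
     (tau (act y (act w v0)) ** z ** ginv (tau (act z (act y (act w v0))))).
    by rewrite -(actD actM y) !gmulA gmulKr.
  rewrite alphaM double_cocycleM //; congr (_ ** double_cocycle _ _ _ _).
  apply: stab_alpha.
  rewrite !(actD actM) tauP -(actD actM w) (actV actM).
  by rewrite -{2}(tauP (w ** y)) permK.
- move=> i v _; rewrite /double_cocycle cocycle_gen /= /pull_label /= -!/(double_cocycle _ _) /D.
  rewrite -/(edge_loop (v, i)); case: c {D} => //=.
  (* On a shared edge the second copy uses the label of the first; this is consistent because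
     [alpha] of the loop lies in [H], where the two copies agree. *)
  have [loopH|//] := boolP (shared (v, i)).
  by apply/esym/double_cocycle_sub/Halpha/asboolP.
by exists gone; rewrite (hom1 actM) perm1.
Qed.

Lemma iter_pull_label (G : AbsGroup) (A : bool * (V * 'I_n) -> G) c m x : act x v0 = v0 ->
  double_cocycle (iter m (@pull_label G) A) c x v0 = double_cocycle A c (iter m alpha x) v0.
Proof.
elim: m x => // m IHm x xv0; rewrite iterS pull_labelP // IHm ?iterSr //.
exact: stab_alpha.
Qed.

(* Labelling the edges of the first copy by their loops, and the unshared edges of the second
   copy by [1], recovers [x] from the first copy and an element of [H] from the second. *)
Lemma double_cocycle_separates x : act x v0 = v0 -> ~ H x ->
  exists A : bool * (V * 'I_n) -> F, double_cocycle A false x v0 <> double_cocycle A true x v0.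
Proof.
move=> xv0 NHx; pose A (e : bool * (V * 'I_n)) := if e.1 then gone else edge_loop e.2.
exists A => eqA; apply: NHx.
have A0 y v : double_cocycle A false y v = tau v ** y ** ginv (tau (act y v)).
  apply: (cocycle_uniq Ffree actM (O := fun=> True)
    (D := fun y v => tau v ** y ** ginv (tau (act y v)))) => //.
  - by move=> *; apply: cocycleM.
  - by move=> u w v' _; rewrite (actD actM) !gmulA gmulKr.
  by move=> i v' _; rewrite /double_cocycle cocycle_gen.
have A1 y : forall v, H (double_cocycle A true y v).
  apply: (free_ind Ffree (P := fun y => forall v, H (double_cocycle A true y v))).
    split=> [v|]; first by rewrite /double_cocycle cocycle1 //; apply: subH.1.
    split=> [u w Hu Hw v|u Hu v]; first by rewrite double_cocycleM; apply: subH.2.1.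
    by rewrite /double_cocycle cocycleV //; apply: subH.2.2; apply: Hu.
  move=> i v; rewrite /double_cocycle cocycle_gen /= /A /variant /=.
  by case: (boolP (shared (v, i))) => [/asboolP|_] //=; apply: subH.1.
by have := A1 x v0; rewrite -eqA A0 xv0 tau0 ginv1 gmulg1 gmul1.
Qed.

Definition some_word x : seq (bool * 'I_n) := projT1 (cid (free_word Ffree x)).

Definition double_word c x := [seq (l.1, variant c l.2) | l <- path_word b act v0 (some_word x)].

Lemma eval_double_word (G : AbsGroup) (A : bool * (V * 'I_n) -> G) c x :
  eval A (double_word c x) = double_cocycle A c x v0.
Proof.
rewrite /double_word /some_word; case: (cid _) => u /= xu; rewrite [in RHS]xu.
rewrite /double_cocycle eval_path_word //; elim: (path_word _ _ _ _) => //= l v ->.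
by case: l => [[] e].
Qed.

Definition discrepancy_word x := double_word false x ++ inv_word (double_word true x).

Lemma eval_discrepancy_word (G : AbsGroup) (A : bool * (V * 'I_n) -> G) x :
  eval A (discrepancy_word x) = gone <-> double_cocycle A false x v0 = double_cocycle A true x v0.
Proof.
rewrite eval_cat eval_inv !eval_double_word; split=> [|->]; last exact: gmulgV.
by move=> e; rewrite -(gmulKr (double_cocycle A false x v0) (double_cocycle A true x v0)) e gmul1.
Qed.

Definition pull_word (e : bool * (V * 'I_n)) := double_word e.1 (alpha (edge_loop e.2)).

Lemma eval_pull_word (G : AbsGroup) (A : bool * (V * 'I_n) -> G) e :
  eval A (pull_word e) = pull_label A e.
Proof. exact: eval_double_word. Qed.
End Doubling.

(** * Quasi-fixed points of polynomial maps *)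

Local Open Scope ring_scope.

(** [msize] is the total degree plus one for a nonzero polynomial, hence the asymmetric bounds. *)
Lemma msizeM_leD (K : idomainType) (N : nat) (p q : {mpoly K[N]}) a b :
  (msize p <= a)%N -> (msize q <= b.+1)%N -> (msize (p * q) <= a + b)%N.
Proof.
have [->|p0] := eqVneq p 0; first by rewrite mul0r msize0.
have [->|q0] := eqVneq q 0; first by rewrite mulr0 msize0.
by rewrite msizeM //; move: (msize p) (msize q) => x y xa yb; lia.
Qed.

(** * A basis of the polynomial ring adapted to the relations *)

Section DivisionBasis.
Variables (K : fieldType) (N Q : nat) (f : 'I_N -> {mpoly K[N]}).
Hypotheses (Q_gt0 : (0 < Q)%N) (fQ : forall i, (msize (f i) <= Q)%N).
Local Notation R := {mpoly K[N]}.

Definition qf_rel (i : 'I_N) : R := 'X_i ^+ Q - f i.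

Definition qf_ideal (g : R) : Prop := exists h : 'I_N -> R, g = \sum_i h i * qf_rel i.

(** The monomial [m] with each full factor ['X_i ^+ Q] replaced by [qf_rel i]. As [f i] has degree
    below [Q], this changes only terms of lower degree. *)
Definition qf_basis (m : 'X_{1..N}) : R :=
  'X_[[multinom (m i %% Q)%N | i < N]] * \prod_i qf_rel i ^+ (m i %/ Q).

Definition led_by (p : R) (m : 'X_{1..N}) := (msize (p - 'X_[m]) <= mdeg m)%N.

Lemma led_byM p q m m' : led_by p m -> led_by q m' -> led_by (p * q) (m + m')%MM.
Proof.
rewrite /led_by => hp hq.
have -> : p * q - 'X_[m + m'] = (p - 'X_[m]) * q + (q - 'X_[m']) * 'X_[m].
  by rewrite mpolyXD mulrBl mulrBl addrA (mulrC q) subrK (mulrC 'X_[m']).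
have sq : (msize q <= (mdeg m').+1)%N.
  rewrite -[q](subrK 'X_[m']); apply: leq_trans (msizeD_le _ _) _.
  by rewrite geq_max msizeX leqnn andbT leqW.
rewrite mdegD; apply: leq_trans (msizeD_le _ _) _; rewrite geq_max msizeM_leD //=.
by rewrite addnC msizeM_leD // msizeX.
Qed.

Lemma led_by1 : led_by 1 0%MM.
Proof. by rewrite /led_by mpolyX0 subrr msize0. Qed.

Lemma led_byXn p m k : led_by p m -> led_by (p ^+ k) (m *+ k)%MM.
Proof.
move=> pm; elim: k => [|k IHk]; first by rewrite expr0 mulm0n led_by1.
by rewrite exprS mulmS led_byM.
Qed.

Lemma led_by_prod (I : finType) (p : I -> R) (m : I -> 'X_{1..N}) :
  (forall i, led_by (p i) (m i)) -> led_by (\prod_i p i) (\sum_i m i)%MM.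
Proof.
move=> pm; apply: (big_ind2 led_by) => //; first exact: led_by1.
by move=> *; apply: led_byM.
Qed.

Lemma led_by_rel i : led_by (qf_rel i) (U_(i) *+ Q)%MM.
Proof. by rewrite /led_by /qf_rel mpolyXn addrAC subrr sub0r msizeN mdegMn mdeg1 mul1n. Qed.

Lemma led_by_basis m : led_by (qf_basis m) m.
Proof.
have {2}-> : m = ([multinom (m i %% Q)%N | i < N] + \sum_i U_(i) *+ Q *+ (m i %/ Q))%MM.
  apply/mnmP => i; rewrite mnmDE mnmE mnm_sumE (bigD1 i) //= big1.
    by rewrite addn0 !mulmnE mnm1E eqxx mul1n addnC mulnC -divn_eq.
  by move=> j ji; rewrite !mulmnE mnm1E (negbTE ji).
apply: led_byM; first by rewrite /led_by subrr msize0.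
by apply: led_by_prod => i; apply/led_byXn/led_by_rel.
Qed.

(** The linear map taking each monomial to its basis element; it is unitriangular for the degree,
    hence bijective. *)
Definition qf_expand (p : R) : R := \sum_(m <- msupp p) p@_m *: qf_basis m.

Lemma qf_expandE k p : (msize p <= k)%N ->
  qf_expand p = \sum_(m : 'X_{1..N < k}) p@_m *: qf_basis m.
Proof.
move=> pk; pose I : subFinType _ := 'X_{1..N < k}.
rewrite /qf_expand (big_mksub I) ?msupp_uniq //=; last first.
  by move=> x /msize_mdeg_lt /leq_trans; apply.
by rewrite big_rmcond //= => i /memN_msupp_eq0 ->; rewrite scale0r.
Qed.

Lemma qf_expandD p q : qf_expand (p + q) = qf_expand p + qf_expand q.
Proof.
pose k := maxn (msize p) (msize q).
rewrite !(@qf_expandE k) ?leq_maxl ?leq_maxr ?(leq_trans (msizeD_le _ _)) // -big_split.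
by apply: eq_bigr => m _; rewrite mcoeffD scalerDl.
Qed.

Lemma qf_expandZ c p : qf_expand (c *: p) = c *: qf_expand p.
Proof.
rewrite !(@qf_expandE (msize p)) ?msizeZ_le // scaler_sumr.
by apply: eq_bigr => m _; rewrite mcoeffZ scalerA.
Qed.

Lemma qf_expand_sum (I : finType) (p : I -> R) :
  qf_expand (\sum_i p i) = \sum_i qf_expand (p i).
Proof.
apply: (big_morph qf_expand qf_expandD).
by rewrite /qf_expand msupp0 big_nil.
Qed.

Lemma qf_expandX m : qf_expand 'X_[m] = qf_basis m.
Proof. by rewrite /qf_expand msuppX big_seq1 mcoeffX eqxx scale1r. Qed.

Lemma msize_expandB p : p != 0 -> (msize (p - qf_expand p) < msize p)%N.
Proof.
move=> p0; have sp := mpolySpred mdeg p0.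
rewrite {1}[p]mpolyE /qf_expand -sumrB.
apply: leq_ltn_trans (msize_sum _ _ _) _.
rewrite [leqRHS]sp ltnS; apply/bigmax_leqP_seq => m mp _.
rewrite -scalerBr; apply: leq_trans (msizeZ_le _ _) _.
rewrite -opprB msizeN; apply: leq_trans (led_by_basis m) _.
by rewrite -ltnS -sp msize_mdeg_lt.
Qed.

Lemma qf_expand_inj p : qf_expand p = 0 -> p = 0.
Proof.
move=> Tp; apply: contra_eq (erefl (msize p)) => /msize_expandB.
by rewrite Tp subr0 ltnn.
Qed.

Lemma qf_expand_surj p : exists q, p = qf_expand q.
Proof.
have [k] := ubnP (msize p); elim: k p => // k IHk p; rewrite ltnS => pk.
have [->|p0] := eqVneq p 0; first by exists 0; rewrite /qf_expand msupp0 big_nil.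
have [|q Tq] := IHk (p - qf_expand p); first by apply: leq_trans (msize_expandB p0) pk.
by exists (p + q); rewrite qf_expandD -Tq addrC subrK.
Qed.

(** Thus [qf_expand] carries the monomial ideal of the ['X_i ^+ Q] onto [qf_ideal]. *)
Lemma qf_expandXQ i p : qf_expand ('X_i ^+ Q * p) = qf_rel i * qf_expand p.
Proof.
rewrite {1}[p]mpolyE mulr_sumr (big_morph qf_expand qf_expandD (id1 := 0)); last first.
  by rewrite /qf_expand msupp0 big_nil.
rewrite [in RHS]/qf_expand mulr_sumr; apply: eq_bigr => m _.
rewrite -scalerAr qf_expandZ mpolyXn -mpolyXD qf_expandX -scalerAr; congr (_ *: _).
rewrite /qf_basis mulrCA; congr (_ * _).
  congr ('X_[_]); apply/mnmP => j; rewrite !mnmE mulmnE mnm1E.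
  by case: eqP => _; rewrite ?mul1n ?mul0n ?modnDl.
rewrite !(bigD1 (P := predT) i) //= mulrA -exprS; congr (_ * _).
  by rewrite mnmDE mulmnE mnm1E eqxx mul1n divnDl // divnn Q_gt0.
apply: eq_bigr => j ji.
by rewrite mnmDE mulmnE mnm1E eq_sym (negbTE ji).
Qed.

Lemma qf_expand_reduced p : (forall m i, m \in msupp p -> (m i < Q)%N) -> qf_expand p = p.
Proof.
move=> pQ; rewrite [RHS]mpolyE /qf_expand; apply: eq_big_seq => m mp; congr (_ *: _).
rewrite /qf_basis big1 ?mulr1 => [|i _]; last by rewrite divn_small ?pQ.
by congr ('X_[_]); apply/mnmP => i; rewrite mnmE modn_small ?pQ.
Qed.

(** [qf_expand] fixes [g], whose exponents are all below [Q]; by injectivity [g] lies in the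
    monomial ideal of the ['X_i ^+ Q], so it is 0. *)
Lemma qf_ideal_small g : qf_ideal g -> (msize g <= Q)%N -> g = 0.
Proof.
case=> h gh gQ.
have red m i : m \in msupp g -> (m i < Q)%N.
  move=> /msize_mdeg_lt mg; apply: leq_trans (leq_trans _ mg) gQ.
  by rewrite ltnS mdegE (bigD1 i) //= leq_addr.
have /fin_all_exists [k hk] i := qf_expand_surj (h i).
have eqg : g = \sum_i 'X_i ^+ Q * k i.
  apply/eqP; rewrite -subr_eq0; apply/eqP/qf_expand_inj.
  rewrite -scaleN1r qf_expandD qf_expandZ scaleN1r (qf_expand_reduced red) qf_expand_sum.
  apply/eqP; rewrite subr_eq0 [X in X == _]gh; apply/eqP/eq_bigr => i _.
  by rewrite qf_expandXQ -hk mulrC.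
apply/mpolyP => m; rewrite mcoeff0.
have [mg|/memN_msupp_eq0//] := boolP (m \in msupp g).
rewrite eqg raddf_sum /= big1 // => i _.
rewrite mpolyXn; apply/eqP; rewrite mcoeff_eq0; apply/negP.
rewrite mulrC => mk.
have : (U_(i) *+ Q <= m)%MM.
  have := msuppMX (k i) (U_(i) *+ Q)%MM; move/perm_mem/(_ m); rewrite mk => /esym /mapP [m' _ ->].
  by rewrite lem_addr.
move=> /mnm_lepP /(_ i); rewrite mulmnE mnm1E eqxx mul1n leqNgt.
by rewrite red.
Qed.

Lemma qf_ideal0 : qf_ideal 0.
Proof. by exists (fun=> 0); rewrite big1 // => i _; rewrite mul0r. Qed.

Lemma qf_idealD g g' : qf_ideal g -> qf_ideal g' -> qf_ideal (g + g').
Proof.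
move=> [h ->] [h' ->]; exists (fun i => h i + h' i).
by rewrite -big_split; apply: eq_bigr => i _; rewrite mulrDl.
Qed.

Lemma qf_idealM r g : qf_ideal g -> qf_ideal (r * g).
Proof.
move=> [h ->]; exists (fun i => r * h i).
by rewrite mulr_sumr; apply: eq_bigr => i _; rewrite mulrA.
Qed.

Lemma qf_idealB g g' : qf_ideal g -> qf_ideal g' -> qf_ideal (g - g').
Proof. by move=> Ig /(qf_idealM (-1)); rewrite mulN1r; apply: qf_idealD. Qed.

Lemma qf_ideal_sum (I : Type) (r : seq I) (P : pred I) (g : I -> R) :
  (forall i, P i -> qf_ideal (g i)) -> qf_ideal (\sum_(i <- r | P i) g i).
Proof. by move=> Ig; apply: big_ind => //; [exact: qf_ideal0 | exact: qf_idealD]. Qed.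

Lemma qf_ideal_rel i : qf_ideal (qf_rel i).
Proof.
exists (fun j => (i == j)%:R); rewrite (bigD1 i) //= eqxx mul1r big1 ?addr0 // => j ji.
by rewrite eq_sym (negbTE ji) mul0r.
Qed.

Lemma qf_reduce g : exists2 r, (forall m i, m \in msupp r -> (m i < Q)%N) & qf_ideal (g - r).
Proof.
have [p ->] := qf_expand_surj g.
pose red (m : 'X_{1..N}) := [forall i, (m i < Q)%N].
exists (\sum_(m <- msupp p | red m) p@_m *: 'X_[m]).
  move=> m i /msupp_sum_le /flatten_mapP [m']; rewrite mem_filter => /andP [/forallP redm' _].
  by move=> /msuppZ_le; rewrite msuppX inE => /eqP ->.
rewrite /qf_expand (bigID red) /= addrAC -sumrB big1 ?add0r => [|m /forallP redm].
  apply: qf_ideal_sum => m; rewrite negb_forall => /existsP [i]; rewrite -leqNgt => Qmi.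
  rewrite -mul_mpolyC; apply: qf_idealM.
  rewrite /qf_basis (bigD1 i) //= -[(m i %/ Q)%N]prednK ?divn_gt0 // exprS -mulrA.
  rewrite [X in qf_ideal X]mulrCA [X in qf_ideal X]mulrC; exact/qf_idealM/qf_ideal_rel.
rewrite -scalerBr /qf_basis [\prod__ _]big1 => [|i _]; last by rewrite divn_small ?redm.
rewrite mulr1; have -> : [multinom (m i %% Q)%N | i < N] = m; last by rewrite subrr scaler0.
by apply/mnmP => i; rewrite mnmE modn_small ?redm.
Qed.
End DivisionBasis.

Lemma leq_expWl m n e : (m <= n -> m ^ e <= n ^ e)%N.
Proof. by case: e => // e mn; rewrite leq_exp2r. Qed.

(** Over a finite field this is a count: there are more coefficient families [c] than possible
    values of [ev c]. *)
Lemma algebraic_dependence (K : finFieldType) (N : nat) (g : 'I_N.+1 -> {mpoly K[N]}) :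
  exists (d : nat) (c : {ffun {ffun 'I_N.+1 -> 'I_d} -> K}),
    (exists a, c a != 0) /\ \sum_a c a *: \prod_j g j ^+ a j = 0.
Proof.
(* Then [B <= d * C] and [C ^ N < d], so [B ^ N < d ^ N.+1]: fewer monomials are available than
   there are products of the [g j]. *)
pose D := \max_j msize (g j); pose C := (N.+1 * D + 1)%N.
pose d := (C ^ N).+1; pose B := (N.+1 * d * D + 1)%N.
exists d; pose A := {ffun 'I_N.+1 -> 'I_d}.
pose ev (c : {ffun A -> K}) : {mpoly K[N]} := \sum_a c a *: \prod_j g j ^+ a j.
have sizeX j k : (msize (g j ^+ k) <= (k * D).+1)%N.
  elim: k => [|k IHk]; first by rewrite expr0 msize1.
  rewrite exprS mulSn; apply: leqW; apply: msizeM_leD IHk.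
  exact: (@leq_bigmax 'I_N.+1 (fun j => msize (g j)) j).
have size_ev c : (msize (ev c) <= B)%N.
  apply: leq_trans (msize_sum _ _ _) _; apply/bigmax_leqP => a _.
  apply: leq_trans (msizeZ_le _ _) _.
  suff: (msize (\prod_j g j ^+ a j) <= (\sum_(j < N.+1) a j * D).+1)%N.
    move/leq_trans; apply; rewrite /B addn1 ltnS.
    apply: leq_trans (leq_sum _ (E2 := fun=> (d * D)%N) _) _ => [j _|].
      by rewrite leq_mul2r (ltnW (ltn_ord _)) orbT.
    by rewrite sum_nat_const card_ord mulnA.
  apply: (big_rec2 (fun (q : {mpoly K[N]}) k => msize q <= k.+1)%N) => [|j k q _ qk].
    by rewrite msize1.
  by rewrite -addSn; apply: msizeM_leD qk; apply: sizeX.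
pose mon (v : {ffun 'I_N -> 'I_B}) := [multinom (v i : nat) | i < N].
pose co (c : {ffun A -> K}) := [ffun v : {ffun 'I_N -> 'I_B} => (ev c)@_(mon v)].
have co_inj c c' : co c = co c' -> ev c = ev c'.
  move=> /ffunP eqc; apply/mpolyP => m.
  have [mB|Bm] := ltnP (mdeg m) B; last first.
    by rewrite !memN_msupp_eq0 // msize_mdeg_ge // (leq_trans (size_ev _)).
  have mi i : (m i < B)%N.
    by apply: leq_trans mB; rewrite ltnS mdegE (bigD1 i) //= leq_addr.
  have <- : mon [ffun i => Ordinal (mi i)] = m by apply/mnmP => i; rewrite mnmE ffunE.
  by have := eqc [ffun i => Ordinal (mi i)]; rewrite !ffunE.
have Ninj : ~ injective co.
  move=> /leq_card; rewrite !card_ffun !card_ord leq_exp2l ?card_finNzRing_gt1 1?leqNgt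
    => [/negP []|//].
  apply: (@leq_ltn_trans (d ^ N * C ^ N)); last first.
    by rewrite [ltnRHS]expnSr ltn_pmul2l // expn_gt0.
  rewrite -expnMn; apply: leq_expWl; rewrite /B /C; lia.
have [c [c' [cc' ec]]] : exists c c', c != c' /\ co c = co c'.
  apply: contrapT => noc; apply: Ninj => c c' ec; apply: contrapT => /eqP cc'.
  by apply: noc; exists c, c'.
exists (c - c'); split.
  have [a] : exists a, c a != c' a.
    apply: contrapT => noa; case/eqP: cc'; apply/ffunP => a; apply: contrapT => /eqP caa.
    by apply: noa; exists a.
  by exists a; rewrite !ffunE subr_eq0.
have ev_eq : ev c = ev c' by apply: co_inj.
rewrite -[RHS](subrr (ev c)) {2}ev_eq /ev -sumrB.
by apply: eq_bigr => a _; rewrite !ffunE scalerBl.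
Qed.

Lemma digits_inj (Q n : nat) (a b : nat -> nat) :
  (forall i, a i < Q)%N -> (forall i, b i < Q)%N ->
  (\sum_(i < n) a i * Q ^ i = \sum_(i < n) b i * Q ^ i)%N ->
  forall i, (i < n)%N -> a i = b i.
Proof.
elim: n a b => // n IHn a b aQ bQ; rewrite !big_ord_recl !expn0 !muln1.
have shift (c : nat -> nat) : (\sum_(i < n) c (lift ord0 i) * Q ^ lift ord0 i =
                Q * \sum_(i < n) c i.+1 * Q ^ i)%N.
  by rewrite big_distrr; apply: eq_bigr => i _; rewrite lift0 expnS mulnCA.
rewrite !shift => eqab.
have eq0 : a 0%N = b 0%N.
  have := congr1 (modn^~ Q) eqab.
  by rewrite ![(Q * _)%N]mulnC ![(_ 0%N + _)%N]addnC !modnMDl !modn_small.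
move: eqab; rewrite eq0 => /addnI /eqP; rewrite eqn_mul2l.
case/orP=> [/eqP Q0 | /eqP eqS]; first by have := aQ 0%N; rewrite Q0.
by case=> // i; rewrite ltnS; apply: (IHn (a \o S) (b \o S)) => // j; rewrite /= ?aQ ?bQ.
Qed.

Lemma digits_lt (Q n : nat) (a : nat -> nat) :
  (forall i, a i < Q)%N -> (\sum_(i < n) a i * Q ^ i < Q ^ n)%N.
Proof.
move=> aQ; elim: n => [|n IHn]; first by rewrite big_ord0.
rewrite big_ord_recr /= expnS; apply: (@leq_trans (Q ^ n + a n * Q ^ n)).
  by rewrite ltn_add2r.
by rewrite -mulSn leq_mul2r aQ orbT.
Qed.

(** * Polynomial maps as Frobenius powers modulo the relations *)

Section QuasiFixed.
Variables (K : finFieldType) (p N : nat) (f : 'I_N -> {mpoly K[N]}).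
Hypotheses (pcharK : p \in [pchar K]) (frobK : forall c : K, c ^+ p = c).
Local Notation R := {mpoly K[N]}.

Definition poly_map : R -> R := mmap (mpolyC N (R := K)) f.
HB.instance Definition _ := GRing.RMorphism.on poly_map.

Lemma poly_mapZ c g : poly_map (c *: g) = c *: poly_map g.
Proof. by rewrite /poly_map mmapZ mul_mpolyC. Qed.

Lemma poly_mapX i : poly_map 'X_i = f i.
Proof. by rewrite /poly_map mmapX mmap1U. Qed.

Section Exponent.
Variable s : nat.
Local Notation Q := (p ^ s)%N.
Local Notation I := (qf_ideal Q f).
Local Notation eqI a b := (I (a - b)).

Lemma eqI_trans a b c : eqI a b -> eqI b c -> eqI a c.
Proof. by move=> ab bc; have := qf_idealD ab bc; rewrite addrA subrK. Qed.

Lemma eqI_refl a : eqI a a.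
Proof. by rewrite subrr; apply: qf_ideal0. Qed.

Lemma eqI_sym a b : eqI a b -> eqI b a.
Proof. by move=> ab; have := qf_idealM (-1) ab; rewrite mulN1r opprB. Qed.

Lemma eqIM a b a' b' : eqI a b -> eqI a' b' -> eqI (a * a') (b * b').
Proof.
move=> ab ab'; have -> : a * a' - b * b' = a' * (a - b) + b * (a' - b').
  by rewrite !mulrBr [a' * b]mulrC addrA subrK [a' * a]mulrC.
by apply: qf_idealD; apply: qf_idealM.
Qed.

Lemma eqIX a b k : eqI a b -> eqI (a ^+ k) (b ^+ k).
Proof.
move=> ab; elim: k => [|k IHk]; first by rewrite !expr0; apply: eqI_refl.
by rewrite !exprS; apply: eqIM.
Qed.

Lemma exprQ_id (c : K) : c ^+ Q = c.
Proof. by elim: s => [|k IHk]; rewrite ?expr1 // expnSr exprM IHk frobK. Qed.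

(** In characteristic [p] both sides are ring homomorphisms in [g] that fix the constants, and the
    relations identify them on the variables. *)
Lemma poly_map_frob g : eqI (poly_map g) (g ^+ Q).
Proof.
have Qp : [pchar R].-nat Q.
  by rewrite pnatX pnatE ?(pcharf_prime pcharK) // (pchar_lalg R) pcharK.
elim/mpolyind: g => [|c m g _ _ IHg].
  rewrite rmorph0 expr0n expn_eq0 (gtn_eqF (prime_gt0 (pcharf_prime pcharK))) subr0.
  exact: qf_ideal0.
rewrite exprDn_pchar // rmorphD /= opprD addrACA; apply: qf_idealD => //.
rewrite poly_mapZ exprZn exprQ_id -scalerBr -mul_mpolyC; apply: qf_idealM.
rewrite mpolyXE_id rmorph_prod -prodrXl.
apply: (big_ind2 (fun a b : R => eqI a b)) => [|a b a' b'|i _].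
- exact: eqI_refl.
- exact: eqIM.
rewrite rmorphXn /= poly_mapX exprAC; apply/eqIX/eqI_sym/qf_ideal_rel.
Qed.

Lemma iter_poly_map_frob j g : eqI (iter j poly_map g) (g ^+ (Q ^ j)).
Proof.
elim: j => [|j IHj]; first by rewrite expr1; apply: eqI_refl.
rewrite iterS; apply: eqI_trans (poly_map_frob _) _.
by rewrite expnSr exprM; apply: eqIX.
Qed.

End Exponent.

Variable P : R.
Hypothesis P_iter : iter N poly_map P != 0.

Lemma msize_expr_le (g : R) k : (msize (g ^+ k) <= (k * msize g).+1)%N.
Proof.
elim: k => [|k IHk]; first by rewrite expr0 msize1.
by rewrite exprS mulSn; apply: leqW; apply: msizeM_leD IHk.
Qed.

Lemma not_nilpotent : exists s : nat,
  [/\ (0 < p ^ s)%N, forall i, (msize (f i) <= p ^ s)%N &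
      forall k, ~ qf_ideal (p ^ s) f (P ^+ k)].
Proof.
have [d [c [[a0 ca0] rel]]] := algebraic_dependence (fun j : 'I_N.+1 => iter j poly_map P).
(* Since [s < p ^ s], this makes [Q] exceed the digits bounded by [d], the sizes of the [f i], and
   the degree of the [d]-th power of the last iterate. *)
pose s := maxn d (maxn (\max_i msize (f i)) (d * msize (iter N poly_map P)).+1).
have p1 : (1 < p)%N := prime_gt1 (pcharf_prime pcharK).
have sQ : (s < p ^ s)%N := ltn_expl s p1.
have fQ i : (msize (f i) <= p ^ s)%N.
  apply: leq_trans (ltnW sQ); rewrite /s !leq_max.
  by rewrite (@leq_bigmax 'I_N (fun i => msize (f i))) orbT.
have Q_gt0 : (0 < p ^ s)%N by rewrite expn_gt0 prime_gt0 ?(pcharf_prime pcharK).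
have dQ : (d < p ^ s)%N by apply: leq_ltn_trans sQ; rewrite leq_maxl.
exists s; split=> // k Pk; pose Q := (p ^ s)%N.
pose val_at (a : {ffun 'I_N.+1 -> 'I_d}) i := oapp (fun j => a j : nat) 0%N (insub i).
have val_atE a (i : 'I_N.+1) : val_at a i = a i by rewrite /val_at valK.
have val_atQ a i : (val_at a i < Q)%N.
  rewrite /val_at; case: insubP => [j _ _|_] //=.
  by apply: ltn_trans dQ.
(* The [j]-th iterate of [P] is congruent to [P ^+ (Q ^ j)], so a product of iterates becomes a
   power of [P] whose exponent has base-[Q] digits [a]. Distinct terms thus keep distinct
   exponents. *)
pose e (a : {ffun 'I_N.+1 -> 'I_d}) := (\sum_(i < N.+1) a i * Q ^ i)%N.
have eE a : e a = (\sum_(i < N.+1) val_at a i * Q ^ i)%N.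
  by apply: eq_bigr => i _; rewrite val_atE.
have e_inj : injective e.
  move=> a a'; rewrite !eE => /(digits_inj (val_atQ a) (val_atQ a')) eqa.
  by apply/ffunP => i; apply: val_inj; have := eqa i (ltn_ord i); rewrite !val_atE.
have e_lt a : (e a <= d * Q ^ N)%N.
  rewrite eE big_ord_recr /= (val_atE a ord_max) addnC.
  apply: leq_trans (leq_add (leqnn _) (ltnW (digits_lt N (val_atQ a)))) _.
  by rewrite -mulSnr leq_mul2r ltn_ord orbT.
have relQ : qf_ideal Q f (\sum_a c a *: P ^+ e a).
  rewrite -[X in qf_ideal _ _ X]subr0 -[X in _ - X]rel -sumrB.
  apply: qf_ideal_sum => a _; rewrite -scalerBr -mul_mpolyC; apply: qf_idealM.
  rewrite /e expr_sum.
  apply: (big_ind2 (fun a b : R => qf_ideal Q f (a - b))) => [|u v u' v'|j _].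
  - exact: eqI_refl.
  - exact: eqIM.
  rewrite mulnC exprM; apply: eqIX; apply/eqI_sym/iter_poly_map_frob.
(* The relation expresses its lowest power of [P] through higher ones, so nilpotency descends to the
   exponent [e a], which is bounded by [d * Q ^ N]. *)
have [a ca a_min] := @arg_minnP _ a0 (fun a => c a != 0) e ca0.
have PX_ge (m m' : nat) : (m <= m')%N -> qf_ideal Q f (P ^+ m) -> qf_ideal Q f (P ^+ m').
  by move=> /subnK <- Pm; rewrite exprD; apply: qf_idealM.
have descend m : (e a <= m)%N -> qf_ideal Q f (P ^+ m.+1) -> qf_ideal Q f (P ^+ m).
  move=> am Pm; have := qf_idealM (P ^+ (m - e a)) relQ.
  rewrite mulr_sumr (bigD1 a) //= -scalerAr -exprD subnK // => Im.
  have : qf_ideal Q f (c a *: P ^+ m).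
    rewrite -[c a *: _](addrK (\sum_(i | i != a) P ^+ (m - e a) * (c i *: P ^+ e i))).
    apply: qf_idealB Im _; apply: qf_ideal_sum => b ba.
    rewrite -scalerAr -exprD; have [->|cb] := eqVneq (c b) 0.
      by rewrite scale0r; apply: qf_ideal0.
    rewrite -mul_mpolyC; apply: qf_idealM; apply: PX_ge Pm.
    have: (e a < e b)%N by rewrite ltn_neqAle (inj_eq e_inj) eq_sym ba a_min.
    by rewrite -(ltn_add2l (m - e a)) subnK.
  move=> /(qf_idealM ((c a)^-1)%:MP); rewrite mul_mpolyC scalerA mulVf // scale1r //.
have Pe : qf_ideal Q f (P ^+ e a).
  elim: k Pk => [|k IHk] Pk; first exact: PX_ge Pk.
  have [ak|ka] := leqP (e a) k; first by apply: IHk; apply: descend.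
  exact: PX_ge Pk.
have : qf_ideal Q f (iter N poly_map P ^+ d).
  rewrite -[X in qf_ideal _ _ X](subrK (P ^+ (d * Q ^ N))); apply: qf_idealD.
    by rewrite mulnC exprM; apply/eqIX/iter_poly_map_frob.
  exact: PX_ge (e_lt a) Pe.
move/(qf_ideal_small Q_gt0 fQ) => /(_ _) Pd0.
have : iter N poly_map P ^+ d = 0.
  apply: Pd0; apply: leq_trans (msize_expr_le _ _) (leq_trans _ (ltnW sQ)).
  by rewrite /s !leq_max leqnn !orbT.
by move/eqP; rewrite expf_eq0 (negbTE P_iter) andbF.
Qed.
End QuasiFixed.

(** * The quotient in which [P] becomes cancellable *)

Section Saturation.
Variables (K : finFieldType) (N Q : nat) (f : 'I_N -> {mpoly K[N]}) (P : {mpoly K[N]}).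
Hypothesis PQ : forall k, ~ qf_ideal Q f (P ^+ k).
Local Notation R := {mpoly K[N]}.

(** The proof passed as argument shows that 1 is not in the ideal, which the ideal structure
    declared below requires. *)
Definition saturation (_ : forall k, ~ qf_ideal Q f (P ^+ k)) : {pred R} :=
  fun g => `[< exists k, qf_ideal Q f (P ^+ k * g) >].

Lemma saturation_idealr : idealr_closed (saturation PQ).
Proof.
split.
- by apply/asboolP; exists 0; rewrite mulr0; apply: qf_ideal0.
- by apply/asboolP => - [k]; rewrite mulr1; apply: PQ.
move=> a u v /asboolP [k uk] /asboolP [l vl]; apply/asboolP; exists (k + l)%N.
rewrite mulrDr exprD; apply: qf_idealD; last by rewrite -mulrA; apply: qf_idealM.
have -> : P ^+ k * P ^+ l * (a * u) = P ^+ l * a * (P ^+ k * u).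
  by rewrite [P ^+ k * _]mulrC mulrACA.
exact: qf_idealM.
Qed.

HB.instance Definition _ := isIdealr.Build R (saturation PQ) saturation_idealr.

Definition saturated_quotient := {ideal_quot (saturation PQ)}.
HB.instance Definition _ := GRing.ComNzRing.on saturated_quotient.

Local Notation pi := (\pi_{ideal_quot (saturation PQ)}%qT : R -> saturated_quotient).

Lemma saturated_quotient_eq g h k : qf_ideal Q f (P ^+ k * (g - h)) -> pi g = pi h.
Proof. by move=> Igh; apply/eqP; rewrite -Quotient.idealrBE; apply/asboolP; exists k. Qed.

Lemma saturated_quotient_eqP g h : pi g = pi h -> exists k, qf_ideal Q f (P ^+ k * (g - h)).
Proof. by move=> /eqP; rewrite -Quotient.idealrBE => /asboolP. Qed.

End Saturation.

Theorem quasi_fixed_point (K : finFieldType) (p N : nat) (f : 'I_N -> {mpoly K[N]})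
    (P : {mpoly K[N]}) :
  p \in [pchar K] -> (forall c : K, c ^+ p = c) -> iter N (poly_map f) P != 0 ->
  exists (S : comNzRingType) (pi : {rmorphism {mpoly K[N]} -> S}) (Q : nat),
    [/\ forall g, pi (poly_map f g) = pi g ^+ Q, exists y, pi P * y = 1 & finitely_many S].
Proof.
move=> pcharK frobK /(not_nilpotent pcharK frobK) [s [Q_gt0 fQ PQ]].
pose S := saturated_quotient PQ.
pose pi : {rmorphism {mpoly K[N]} -> S} := \pi_{ideal_quot (saturation PQ)}%qT.
have finS : finitely_many S.
  pose mk (c : {ffun {ffun 'I_N -> 'I_(p ^ s)} -> K}) : {mpoly K[N]} :=
    \sum_v c v *: 'X_[[multinom (v i : nat) | i < N]].
  have surj x : exists c, pi (mk c) == x.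
    have [r red Ir] := qf_reduce Q_gt0 fQ (generic_quotient.repr x).
    exists [ffun v : {ffun 'I_N -> 'I_(p ^ s)} => r@_[multinom (v i : nat) | i < N]].
    have -> : mk [ffun v : {ffun 'I_N -> 'I_(p ^ s)} => r@_[multinom (v i : nat) | i < N]] = r.
      pose mon (v : {ffun 'I_N -> 'I_(p ^ s)}) := [multinom (v i : nat) | i < N].
      have mon_inj : injective mon.
        move=> v v' /mnmP eqv; apply/ffunP => i; apply: val_inj.
        by have := eqv i; rewrite !mnmE.
      rewrite /mk; under eq_bigr do rewrite ffunE.
      apply/mpolyP => m; rewrite raddf_sum /=.
      under eq_bigr do rewrite mcoeffZ mcoeffX.
      have [mr|mNr] := boolP (m \in msupp r).
        have [v vm] : exists v, mon v = m.
          exists [ffun i => Ordinal (red m i mr)].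
          by apply/mnmP => i; rewrite mnmE ffunE.
        rewrite (bigD1 v) //= -/(mon v) vm eqxx mulr1 big1 ?addr0 // => v' v'v.
        by rewrite -/(mon v') -vm (inj_eq mon_inj) (negbTE v'v) mulr0.
      rewrite big1 ?memN_msupp_eq0 // => v _.
      by case: eqP => [->|_]; rewrite ?mulr0 // memN_msupp_eq0 ?mul0r.
    rewrite eq_sym -[x]reprK; apply/eqP/(@saturated_quotient_eq _ _ _ _ _ _ _ _ 0).
    by rewrite expr0 mul1r.
  exists {ffun {ffun 'I_N -> 'I_(p ^ s)} -> K}, (fun x => xchoose (surj x)).
  move=> x y eqxy.
  by rewrite -(eqP (xchooseP (surj x))) eqxy (eqP (xchooseP (surj y))).
exists S, pi, (p ^ s)%N; split=> //.
- move=> g; rewrite -rmorphXn; apply: (@saturated_quotient_eq _ _ _ _ _ _ _ _ 0).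
  by rewrite expr0 mul1r; apply: poly_map_frob.
(* Two powers of [P] coincide in the finite quotient; cancelling the lower one, as saturation
   permits, gives an inverse of [P]. *)
have [i [j [ij Pij]]] := pigeonhole (fun i => pi P ^+ i) finS.
exists (pi P ^+ (j - i).-1); rewrite -exprS prednK ?subn_gt0 // -rmorphXn -[1](rmorph1 pi).
move: Pij; rewrite -!rmorphXn => /saturated_quotient_eqP [k Ik].
apply: (@saturated_quotient_eq _ _ _ _ _ _ _ _ (k + i)%N).
have -> : P ^+ (k + i) * (P ^+ (j - i) - 1) = - 1 * (P ^+ k * (P ^+ i - P ^+ j)).
  by rewrite exprD -mulrA mulrBr -exprD subnKC 1?ltnW // mulr1 mulN1r -mulrN opprB.
exact: qf_idealM.
Qed.

(** * Words in 2 x 2 matrices *)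

Section GL2.
Variable R : comNzRingType.
Implicit Types M N : 'M[R]_2.

(** Each matrix is stored with its inverse, so that group inversion is a swap. *)
Definition gl2_type := {AB : 'M[R]_2 * 'M[R]_2 | (AB.1 *m AB.2 == 1%:M) && (AB.2 *m AB.1 == 1%:M)}.

Lemma gl2_mulP (x y : gl2_type) :
  ((val x).1 *m (val y).1 *m ((val y).2 *m (val x).2) == 1%:M) &&
  ((val y).2 *m (val x).2 *m ((val x).1 *m (val y).1) == 1%:M).
Proof.
case: x y => [[A B] /= /andP [/eqP AB /eqP BA]] [[C D] /= /andP [/eqP CD /eqP DC]].
by rewrite mulmxA -(mulmxA A) CD mulmx1 AB mulmxA -(mulmxA D) BA mulmx1 DC eqxx.
Qed.

Definition gl2_mul (x y : gl2_type) : gl2_type :=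
  exist _ ((val x).1 *m (val y).1, (val y).2 *m (val x).2) (gl2_mulP x y).

Lemma gl2_oneP : (1%:M *m 1%:M == 1%:M :> 'M[R]_2) && (1%:M *m 1%:M == 1%:M :> 'M[R]_2).
Proof. by rewrite mulmx1 eqxx. Qed.

Definition gl2_one : gl2_type := exist _ (1%:M, 1%:M) gl2_oneP.

Lemma gl2_invP (x : gl2_type) :
  ((val x).2 *m (val x).1 == 1%:M) && ((val x).1 *m (val x).2 == 1%:M).
Proof. by rewrite andbC (valP x). Qed.

Definition gl2_inv (x : gl2_type) : gl2_type := exist _ ((val x).2, (val x).1) (gl2_invP x).

Lemma gl2_mulA x y z : gl2_mul x (gl2_mul y z) = gl2_mul (gl2_mul x y) z.
Proof. by apply: val_inj; rewrite /= !mulmxA. Qed.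

Lemma gl2_mul1 x : gl2_mul gl2_one x = x.
Proof. by apply: val_inj; rewrite /= mul1mx mulmx1; case: (val x). Qed.

Lemma gl2_mulV x : gl2_mul (gl2_inv x) x = gl2_one.
Proof. by apply: val_inj => /=; have /andP [_ /eqP ->] := valP x. Qed.

Definition gl2 : AbsGroup := Build_AbsGroup gl2_mulA gl2_mul1 gl2_mulV.

Definition gl2_mx (x : gl2) : 'M[R]_2 := (val (x : gl2_type)).1.

Lemma finitely_many_gl2 : finitely_many R -> finitely_many gl2.
Proof.
move=> [T [phi phi_inj]].
exists ({ffun 'I_2 * 'I_2 -> T} * {ffun 'I_2 * 'I_2 -> T})%type.
exists (fun x : gl2_type => ([ffun ij => phi ((val x).1 ij.1 ij.2)],
                             [ffun ij => phi ((val x).2 ij.1 ij.2)])).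
move=> x y [/ffunP eq1 /ffunP eq2]; apply: val_inj.
rewrite [val x]surjective_pairing [val y]surjective_pairing; congr pair; apply/matrixP => i j.
  by apply: phi_inj; have := eq1 (i, j); rewrite !ffunE.
by apply: phi_inj; have := eq2 (i, j); rewrite !ffunE.
Qed.

Lemma gl2_lift M d : \det M * d = 1 -> exists x : gl2, gl2_mx x = M.
Proof.
move=> Md.
have inv : (M *m (d *: \adj M) == 1%:M) && (d *: \adj M *m M == 1%:M).
  by rewrite -scalemxAr -scalemxAl mul_mx_adj mul_adj_mx scale_scalar_mx mulrC Md !eqxx.
by exists (exist _ (M, d *: \adj M) inv).
Qed.

(** The adjugate equals the inverse up to the determinant, so words evaluated with adjugates are
    correct up to a unit scalar. *)
Definition represents (x : gl2) M := exists2 c, exists d, c * d = 1 & gl2_mx x = c *: M.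

Lemma representsxx x : represents x (gl2_mx x).
Proof. by exists 1; rewrite ?scale1r //; exists 1; rewrite mulr1. Qed.

Lemma representsM x y M N : represents x M -> represents y N -> represents (x ** y) (M *m N).
Proof.
move=> [c [c' cc'] xM] [d [d' dd'] yN]; exists (c * d).
  by exists (c' * d'); rewrite mulrACA cc' dd' mulr1.
by rewrite /gl2_mx /= -!/(gl2_mx _) xM yN -scalemxAl -scalemxAr scalerA.
Qed.

Lemma det_represents x M : represents x M -> exists d, \det M * d = 1.
Proof.
move=> [c _ xM]; exists (c ^+ 2 * \det ((val (x : gl2_type)).2)).
have /andP [/eqP e _] := valP (x : gl2_type).
by rewrite mulrA [\det M * _]mulrC -detZ -xM -det_mulmx e det1.
Qed.

Lemma representsV x M : represents x M -> represents (ginv x) (\adj M).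
Proof.
move=> xM; have [d Md] := det_represents xM; have [c [c' cc'] xcM] := xM.
exists (c' * d); first by exists (c * \det M); rewrite mulrACA [c' * c]mulrC cc' mul1r mulrC.
have /andP [/eqP xx' /eqP x'x] := valP (x : gl2_type).
rewrite /gl2_mx /=; rewrite /gl2_mx in xcM; set B := (sval x).2.
have eM : M = c' *: (val (x : gl2_type)).1 by rewrite xcM scalerA mulrC cc' scale1r.
have -> : B = B *m (d *: (M *m \adj M)).
  by rewrite mul_mx_adj scale_scalar_mx mulrC Md mulmx1.
by rewrite {1}eM -scalemxAl -!scalemxAr mulmxA x'x mul1mx scalerA mulrC.
Qed.

Lemma represents_entry0 x M N i j : represents x M -> represents x N -> M i j = 0 -> N i j = 0.
Proof.
move=> [c _ xM] [d [d' dd']]; rewrite xM => /matrixP /(_ i j); rewrite !mxE => e M0.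
by rewrite -[N i j]mul1r -dd' mulrAC -e M0 mulr0 mul0r.
Qed.

(** A vanishing off-diagonal entry is insensitive to scalars, so it can witness triviality in spite
    of the adjugates. *)
Lemma represents1 M : represents gone M -> M 0 1 = 0.
Proof. by move=> M1; apply: represents_entry0 (representsxx gone) M1 _; rewrite mxE. Qed.

Section Evaluation.
Variable E : Type.

Definition eval_mx (M : E -> 'M[R]_2) (u : seq (bool * E)) : 'M[R]_2 :=
  foldr (fun l N => (if l.1 then M l.2 else \adj (M l.2)) *m N) 1%:M u.

Lemma represents_eval (A : E -> gl2) (M : E -> 'M[R]_2) u :
  (forall e, represents (A e) (M e)) -> represents (eval A u) (eval_mx M u).
Proof.
move=> AM; elim: u => [|[[] e] u IHu] /=; first exact: (representsxx gone).
  by apply: representsM IHu; apply: AM.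
by apply: representsM IHu; apply/representsV/AM.
Qed.
End Evaluation.
End GL2.

Lemma map_eval_mx (R S : comNzRingType) (phi : {rmorphism R -> S}) (E : Type) (M : E -> 'M[R]_2) u :
  map_mx phi (eval_mx M u) = eval_mx (fun e => map_mx phi (M e)) u.
Proof.
elim: u => [|[[] e] u IHu] /=; first by rewrite map_mx1.
  by rewrite map_mxM IHu.
by rewrite map_mxM IHu map_mx_adj.
Qed.

Lemma eq_eval_mx (R : comNzRingType) (E : Type) (M N : E -> 'M[R]_2) u :
  M =1 N -> eval_mx M u = eval_mx N u.
Proof. by move=> MN; elim: u => //= l u ->; rewrite MN. Qed.

Section Reduction.
Variable E : eqType.
Implicit Types (l : bool * E) (u : seq (bool * E)).

Definition flip l := (~~ l.1, l.2).
Definition reduced u := sorted (fun l l' => l' != flip l) u.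
Definition reduce_cons l u := if u is l' :: u' then if l' == flip l then u' else l :: u else [:: l].
Definition reduce u := foldr reduce_cons [::] u.

Lemma reduced_reduce u : reduced (reduce u).
Proof.
elim: u => //= l u; case: (reduce u) => //= l' u' red.
by case: ifP => [_|/negbT ll']; [apply: path_sorted red | rewrite /= ll'].
Qed.

Lemma eval_reduce (G : AbsGroup) (A : E -> G) u : eval A (reduce u) = eval A u.
Proof.
elim: u => //= l u <-; case: (reduce u) => //= l' u'.
case: eqP => [->|//]; case: l => [[] e]; rewrite /eval_letter /=.
  by rewrite gmulVK.
by rewrite gmulKV.
Qed.
End Reduction.

(** * Matrices on which nontrivial words stay nonscalar *)

Section FreeRepresentation.
Variables (K : fieldType) (E : eqType) (a : bool * E -> K).
Hypothesis a_inj : injective a.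
Implicit Types (l : bool * E) (u : seq (bool * E)).

(** The column [(1, x)] times the row [(y, -1)]; this row annihilates the column [(1, z)] exactly
    when [y = z]. *)
Definition rank1_mx (x y : K) : 'M[K]_2 :=
  \matrix_(i, j) ((if i == 0 then 1 else x) * (if j == 0 then y else -1)).

Lemma rank1_mxM x y z t : rank1_mx x y *m rank1_mx z t = (y - z) *: rank1_mx x t.
Proof.
apply/matrixP => i j; rewrite !mxE !big_ord_recl big_ord0 !mxE /=; ring.
Qed.

(** The sign makes the matrix of an inverse letter the adjugate of that of the letter. As [a] is
    injective, two consecutive letters have product 0 only when they cancel. *)
Definition letter_mx l := (-1) ^+ (~~ l.1) *: rank1_mx (a l) (a (flip l)).

Definition free_mx (e : E) : 'M[{poly K}]_2 := 1%:M + 'X *: map_mx polyC (letter_mx (true, e)).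

Lemma adj_free_mx e : \adj (free_mx e) = 1%:M + 'X *: map_mx polyC (letter_mx (false, e)).
Proof.
apply/matrixP => i j; rewrite mxE /cofactor det_mx11 !mxE.
case: i => [[|[|//]] i2]; case: j => [[|[|//]] j2];
  rewrite /flip /= !polyCM ?polyCN ?polyC1 /=; ring.
Qed.

Definition lead_mx u := foldr (fun l W => letter_mx l *m W) 1%:M u.

Lemma coef_eval_free_mx u k : (size u <= k)%N ->
  map_mx (coefp k) (eval_mx free_mx u) = if k == size u then lead_mx u else 0.
Proof.
elim: u k => [|l u IHu] k.
  move=> _; apply/matrixP => i j; rewrite !mxE /= coefMn coef1.
  by case: k => [|k]; rewrite !mxE ?mul0rn.
case: k => // k; rewrite [size _]/= ltnS eqSS => uk.
have -> : eval_mx free_mx (l :: u) =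
    (1%:M + 'X *: map_mx polyC (letter_mx l)) *m eval_mx free_mx u.
  by case: l => [[] e] //=; rewrite adj_free_mx.
have -> : lead_mx (l :: u) = letter_mx l *m lead_mx u by [].
rewrite mulmxDl mul1mx -scalemxAl.
have -> : map_mx (coefp k.+1)
      (eval_mx free_mx u + 'X *: (map_mx polyC (letter_mx l) *m eval_mx free_mx u))
    = map_mx (coefp k.+1) (eval_mx free_mx u) + letter_mx l *m map_mx (coefp k) (eval_mx free_mx u).
  apply/matrixP => i j; rewrite !mxE /= coefD; congr (_ + _).
  rewrite coefXM coef_sum; apply: eq_bigr => m _.
  by rewrite !mxE coefCM.
rewrite IHu ?leqW // IHu // gtn_eqF ?ltnS // add0r.
by case: eqP => // _; rewrite mulmx0.
Qed.

Lemma lead_mx_reduced l u : reduced (l :: u) ->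
  exists2 c, c != 0 & exists y, lead_mx (l :: u) = c *: rank1_mx (a l) y.
Proof.
elim: u l => [|l' u IHu] l red.
  exists ((-1) ^+ (~~ l.1)); first by rewrite signr_eq0.
  by exists (a (flip l)); rewrite /= mulmx1.
have /andP [ll' red'] : (l' != flip l) && reduced (l' :: u) by [].
have [c c0 [y eqy]] := IHu l' red'.
exists ((-1) ^+ (~~ l.1) * c * (a (flip l) - a l')).
  by rewrite !mulf_neq0 ?signr_eq0 // subr_eq0 (inj_eq a_inj) eq_sym.
exists y; have -> : lead_mx [:: l, l' & u] = letter_mx l *m lead_mx (l' :: u) by [].
rewrite eqy.
by rewrite /letter_mx -scalemxAl -scalemxAr rank1_mxM !scalerA.
Qed.

(** The coefficient of degree [size u] in this entry is [- c], with [c] the nonzero scalar from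
    [lead_mx_reduced]. *)
Lemma eval_free_mx_neq0 u : reduced u -> u != [::] -> eval_mx free_mx u 0 1 != 0.
Proof.
case: u => // l u red _; have [c c0 [y eqy]] := lead_mx_reduced red.
apply: contraNneq c0 => ev0.
have /matrixP /(_ 0 1) := coef_eval_free_mx (leqnn (size (l :: u))).
by rewrite mxE ev0 eqxx eqy !mxE /= coef0 mul1r mulrN1 => /esym/eqP; rewrite oppr_eq0.
Qed.

Lemma det_free_mx_neq0 e : \det (free_mx e) != 0.
Proof.
apply/eqP => /(congr1 (horner_eval 0)); rewrite -det_map_mx.
have -> : map_mx (horner_eval 0) (free_mx e) = 1%:M.
  apply/matrixP => i j; rewrite !mxE /= /horner_eval !hornerE ?mul0r ?addr0.
  by case: (i == j); rewrite !hornerE.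
by rewrite det1 rmorph0 => /eqP; rewrite oner_eq0.
Qed.

(** Over the fraction field the determinants are units, so [u] and its nonempty reduction represent
    the same element and their entries vanish together. *)
Theorem free_representation (G : AbsGroup) (A : E -> G) u : eval A u <> gone ->
  exists (k : fieldType) (phi : {rmorphism K -> k}) (M : E -> 'M[k]_2),
    (forall e, \det (M e) != 0) /\ eval_mx M u 0 1 != 0.
Proof.
move=> Au; pose k := {fraction {poly K}}.
pose phi : {rmorphism K -> k} := @tofrac {poly K} \o polyC.
pose M e := map_mx (@tofrac {poly K}) (free_mx e).
have detM e : \det (M e) != 0 by rewrite det_map_mx tofrac_eq0 det_free_mx_neq0.
exists k, phi, M; split=> //.
have [x xM] := choice (fun e => gl2_lift (divff (detM e))).
have repM e : represents (x e) (M e) by rewrite -xM; apply: representsxx.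
have eu := represents_eval u repM.
have er := represents_eval (reduce u) repM.
have r0 : reduce u != [::] by apply: contra_not_neq Au => e; rewrite -eval_reduce e.
have := eval_free_mx_neq0 (reduced_reduce u) r0.
rewrite -tofrac_eq0; have -> : tofrac (eval_mx free_mx (reduce u) 0 1) = eval_mx M (reduce u) 0 1.
  by rewrite -map_eval_mx mxE.
by apply: contra_neq; apply: represents_entry0 eu _; rewrite -(eval_reduce x u).
Qed.
End FreeRepresentation.

Lemma large_prime_field m : exists (K : finFieldType) (p : nat),
  [/\ p \in [pchar K], forall c : K, c ^+ p = c & (m <= #|K|)%N].
Proof.
have [p mp p_pr] := prime_above m; exists 'F_p, p; split; first exact: pchar_Fp.
  by move=> c; rewrite -(pFrobenius_autE (pchar_Fp p_pr)) -[c]natr_Zp pFrobenius_aut_nat.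
by rewrite card_Fp // ltnW.
Qed.

Lemma rmorph_eval_mx (R S : comNzRingType) (phi : {rmorphism R -> S}) (E : Type)
    (M : E -> 'M[R]_2) (N : E -> 'M[S]_2) u i j :
  (forall e, map_mx phi (M e) = N e) -> phi (eval_mx M u i j) = eval_mx N u i j.
Proof.
move=> MN; transitivity (map_mx phi (eval_mx M u) i j); first by rewrite mxE.
by rewrite map_eval_mx (eq_eval_mx _ MN).
Qed.

(** * Iterated substitutions and generic matrices *)

Section Substitution.
Variables (E : finType) (delta : E -> seq (bool * E)).

Definition pull (G : AbsGroup) (A : E -> G) e := eval A (delta e).
Definition pull_mx (R : comNzRingType) (M : E -> 'M[R]_2) e := eval_mx M (delta e).

Definition subst_word (u : seq (bool * E)) :=
  flatten [seq if l.1 then delta l.2 else inv_word (delta l.2) | l <- u].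

Lemma eval_subst_word (G : AbsGroup) (A : E -> G) u : eval A (subst_word u) = eval (pull A) u.
Proof.
elim: u => //= l u IHu; rewrite eval_cat -/(subst_word u) IHu; congr (_ ** _).
by case: l => [[] e] //=; rewrite eval_inv.
Qed.

Lemma eval_iter_pull (G : AbsGroup) (A : E -> G) m u :
  eval (iter m (@pull G) A) u = eval A (iter m subst_word u).
Proof. by elim: m u => // m IHm u; rewrite iterS -eval_subst_word IHm -iterSr. Qed.

Lemma represents_iter_pull (R : comNzRingType) (A : E -> gl2 R) (M : E -> 'M[R]_2) m e :
  (forall e, represents (A e) (M e)) ->
  represents (iter m (@pull (gl2 R)) A e) (iter m (@pull_mx R) M e).
Proof. by move=> AM; elim: m e => //= m IHm e; apply: represents_eval. Qed.

Lemma eq_iter_pull_mx (R : comNzRingType) (M N : E -> 'M[R]_2) m :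
  M =1 N -> iter m (@pull_mx R) M =1 iter m (@pull_mx R) N.
Proof. by move=> MN; elim: m => //= m IHm e; apply: eq_eval_mx. Qed.

Lemma map_iter_pull_mx (R S : comNzRingType) (phi : {rmorphism R -> S}) (M : E -> 'M[R]_2) m e :
  map_mx phi (iter m (@pull_mx R) M e) = iter m (@pull_mx S) (fun e => map_mx phi (M e)) e.
Proof.
elim: m e => //= m IHm e; rewrite /pull_mx map_eval_mx.
exact: eq_eval_mx.
Qed.

Section Generic.
Variable K : finFieldType.
Local Notation N := #|{: E * ('I_2 * 'I_2)}|.
Local Notation R := {mpoly K[N]}.

Definition generic_mx (e : E) : 'M[R]_2 := \matrix_(i, j) 'X_(enum_rank (e, (i, j))).
Definition pull_poly (k : 'I_N) : R :=
  let q := enum_val k in pull_mx generic_mx q.1 q.2.1 q.2.2.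
Local Notation sigma := (poly_map pull_poly).

Lemma map_generic_mx e : map_mx sigma (generic_mx e) = pull_mx generic_mx e.
Proof. by apply/matrixP => i j; rewrite !mxE poly_mapX /pull_poly enum_rankK. Qed.

Lemma map_iter_generic_mx m e :
  map_mx sigma (iter m (@pull_mx R) generic_mx e) = iter m.+1 (@pull_mx R) generic_mx e.
Proof.
rewrite map_iter_pull_mx iterSr; apply: eq_iter_pull_mx => e'.
exact: map_generic_mx.
Qed.

Lemma iter_eval_generic_mx m u i j :
  iter m sigma (eval_mx generic_mx u i j) = eval_mx (iter m (@pull_mx R) generic_mx) u i j.
Proof.
elim: m => [|m IHm]; first exact: erefl.
rewrite iterS IHm.
by apply: rmorph_eval_mx => e; apply: map_iter_generic_mx.
Qed.

Lemma iter_det_generic_mx m e :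
  iter m sigma (\det (generic_mx e)) = \det (iter m (@pull_mx R) generic_mx e).
Proof.
elim: m => [|m IHm]; first exact: erefl.
rewrite iterS IHm -det_map_mx; congr (\det _).
exact: map_iter_generic_mx.
Qed.

Lemma iter_poly_mapM m (x y : R) : iter m sigma (x * y) = iter m sigma x * iter m sigma y.
Proof. by elim: m => //= m ->; rewrite rmorphM. Qed.

Lemma iter_poly_map1 m : iter m sigma 1 = 1.
Proof. by elim: m => //= m ->; rewrite rmorph1. Qed.

(* Where [certificate u] does not vanish, the matrices are invertible and [u] evaluates to a
   non-scalar matrix. *)
Definition certificate u : R := (\prod_e \det (generic_mx e)) * eval_mx generic_mx u 0 1.

Lemma iter_certificate m u : iter m sigma (certificate u) =
  (\prod_e \det (iter m (@pull_mx R) generic_mx e)) *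
  eval_mx (iter m (@pull_mx R) generic_mx) u 0 1.
Proof.
rewrite /certificate iter_poly_mapM iter_eval_generic_mx; congr (_ * _).
rewrite (big_morph _ (iter_poly_mapM m) (iter_poly_map1 m)).
by apply: eq_bigr => e _; rewrite iter_det_generic_mx.
Qed.

(** The generic matrices are specialized to a representation that detects the [m]-fold substitution
    of [u]; the iterated matrices remain invertible because they represent elements of [gl2]. *)
Lemma iter_certificate_neq0 (a : bool * E -> K) (G : AbsGroup) (A : E -> G) m u :
  injective a -> eval (iter m (@pull G) A) u <> gone -> iter m sigma (certificate u) != 0.
Proof.
move=> a_inj; rewrite eval_iter_pull => /(free_representation a_inj) [k [phi [M [detM uM]]]].
pose h (q : 'I_N) := M (enum_val q).1 (enum_val q).2.1 (enum_val q).2.2.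
pose ev : {rmorphism R -> k} := mmap phi h.
have evG e : map_mx ev (generic_mx e) = M e.
  by apply/matrixP => i j; rewrite !mxE /= mmapX mmap1U /h enum_rankK.
have evG_iter e : map_mx ev (iter m (@pull_mx R) generic_mx e) = iter m (@pull_mx k) M e.
  by rewrite map_iter_pull_mx; apply: eq_iter_pull_mx.
apply: contra_neq (_ : ev (iter m sigma (certificate u)) != 0) => [->|]; first by rewrite rmorph0.
have [x xM] := choice (fun e => gl2_lift (divff (detM e))).
have repM e : represents (x e) (M e) by rewrite -xM; apply: representsxx.
have rep_iter e := represents_iter_pull m e repM.
rewrite iter_certificate rmorphM rmorph_prod mulf_neq0 //.
  apply/prodf_neq0 => e _; rewrite -det_map_mx evG_iter.
  have [d ed] := det_represents (rep_iter e).
  by apply: contraTneq (oner_neq0 k) => d0; rewrite -ed d0 mul0r eqxx.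
have eu := represents_eval (iter m subst_word u) repM.
have er := represents_eval u rep_iter.
have -> : ev (eval_mx (iter m (@pull_mx R) generic_mx) u 0 1) =
    eval_mx (iter m (@pull_mx k) M) u 0 1.
  exact: rmorph_eval_mx.
by apply: contra_neq uM; apply: represents_entry0 er _; rewrite eval_iter_pull.
Qed.
End Generic.

Theorem finite_image_of_iterates (u : seq (bool * E)) :
  (forall m, exists (G : AbsGroup) (A : E -> G), eval (iter m (@pull G) A) u <> gone) ->
  exists (G : AbsGroup) (A : E -> G), finitely_many G /\
    forall m, eval (iter m (@pull G) A) u <> gone.
Proof.
move=> nontriv.
have [K [p [pcharK frobK Kbig]]] := large_prime_field #|{: bool * E}|.
pose a (l : bool * E) : K := enum_val (widen_ord Kbig (enum_rank l)).
have a_inj : injective a.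
  by move=> l l' /enum_val_inj /(congr1 val) /= /val_inj /enum_rank_inj.
set N := #|{: E * ('I_2 * 'I_2)}|.
(* [N] is the number of matrix entries, the number of iterations that [quasi_fixed_point] asks
   for. *)
have [G [A GA]] := nontriv N.
have := iter_certificate_neq0 a_inj GA.
move=> /(quasi_fixed_point pcharK frobK) [S [pi [Q [piQ [y Py] finS]]]].
pose M e := map_mx pi (generic_mx K e).
have detM e : exists d, \det (M e) * d = 1.
  pose r := (\prod_(e' | e' != e) \det (generic_mx K e')) * eval_mx (generic_mx K) u 0 1.
  have certE : certificate K u = \det (generic_mx K e) * r.
    by rewrite /certificate (bigD1 e) //= mulrA.
  by exists (pi r * y); rewrite /M det_map_mx mulrA -rmorphM -certE.
have liftM e : exists x : gl2 S, gl2_mx x = M e.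
  by have [d ed] := detM e; apply: gl2_lift ed.
have [x xM] := choice liftM.
have repM e : represents (x e) (M e) by rewrite -xM; apply: representsxx.
exists (gl2 S), x; split; first exact: finitely_many_gl2.
move=> m um; have := represents_eval u (fun e => represents_iter_pull m e repM).
rewrite um => /represents1.
(* In the quotient each substitution raises the entry to the power [Q]. The entry divides the unit
   [pi] of the certificate, so its powers never vanish. *)
have -> : eval_mx (iter m (@pull_mx S) M) u 0 1 = pi (eval_mx (generic_mx K) u 0 1) ^+ (Q ^ m).
  have -> : eval_mx (iter m (@pull_mx S) M) u 0 1 =
      pi (iter m (poly_map (pull_poly K)) (eval_mx (generic_mx K) u 0 1)).
    rewrite iter_eval_generic_mx.
    by apply/esym/rmorph_eval_mx => e; rewrite map_iter_pull_mx.
  by elim: m {um} => // m IHm; rewrite iterS piQ IHm -exprM expnSr.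
move=> g0; have := oner_neq0 S; rewrite -(expr1n _ (Q ^ m)%N) -Py /certificate rmorphM.
by rewrite mulrAC exprMn g0 mulr0 eqxx.
Qed.
End Substitution.

Local Close Scope ring_scope.

(** * The closure criterion *)

Theorem theorem5p1 (F : AbsGroup) (n : nat) (b : 'I_n -> F) (alpha : F -> F)
    (M : AbsGroup) (kappa : F -> M) (t : M) (H : F -> Prop) :
  is_free_on b -> is_hom alpha -> injective alpha ->
  is_mapping_torus alpha kappa t ->
  fg_subgroup H -> (forall h, H h -> H (alpha h)) ->
  forall w : F,
    pclosure (fun z => exists h, H h /\ z = pj (kappa h)) (pj (kappa w))
    <-> exists k : nat, H (iter k alpha w).
Proof.
move=> Ffree alphaM _ torus [subH [k [s Hs]]] Halpha w.
split=> [clw|]; last exact: (closure_of_iter torus Halpha).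
apply: contrapT => Nw.
have Niter m : ~ H (iter m alpha w) by move=> Hm; apply: Nw; exists m.
have [V [act [v0 [tau [[actM Hfix stab] [tau0 tauP Hpath]]]]]] :=
  stable_cover Ffree alphaM subH Hs Halpha.
have [[m wm]|Nstab] := pselect (exists m, act (iter m alpha w) v0 = v0); last first.
  have finV : finitely_many (abs_group {perm V}) by exists {perm V}, id.
  apply: (not_closure Ffree alphaM torus Halpha actM finV (i0 := 0)) clw => i h _ Hh ew.
  by apply: Nstab; exists i; rewrite ew Hfix.
(* Membership in the closure passes to iterates, so [w] may be replaced by one that fixes [v0]; then
   all further iterates fix [v0]. *)
pose w' := iter m alpha w.
have stab_iter i : act (iter i alpha w') v0 = v0 by elim: i => //= i; apply: stab.
pose delta := pull_word alpha H Ffree act v0 tau.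
pose dc := @double_cocycle F n b H Ffree V act tau.
have evalE (G : AbsGroup) (A : bool * (V * 'I_n) -> G) i :
    eval (iter i (@pull _ delta G) A) (discrepancy_word H Ffree act v0 tau w') = gone <->
    dc G A false (iter i alpha w') v0 = dc G A true (iter i alpha w') v0.
  have -> : @pull _ delta G = @pull_label F n b alpha H Ffree V act v0 tau G.
    by apply/funext => B; apply/funext => e; apply: eval_pull_word.
  rewrite eval_discrepancy_word // /dc.
  by rewrite !(iter_pull_label Ffree alphaM Hs Halpha actM Hfix stab tau0 tauP Hpath).
have [|G [A [finG sep]]] := finite_image_of_iterates (delta := delta)
    (u := discrepancy_word H Ffree act v0 tau w').
  (* Labels in [F] itself detect each iterate separately. *)
  move=> i; exists F; have [||A NA] :=
    double_cocycle_separates Ffree subH actM tau0 (x := iter i alpha w') (H := H).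
  - exact: stab_iter.
  - by rewrite /w' -iterD; apply: Niter.
  by exists A => /evalE.
(* The two coordinates carry the two labellings: at [v0] they agree on [H] and differ on every
   iterate of [w']. *)
pose rho x : pair_group (wreath V G) (wreath V G) :=
  (wreath_hom act Ffree (A \o variant b H act tau false) x,
   wreath_hom act Ffree (A \o variant b H act tau true) x).
have rhoM : is_hom rho by move=> x y; congr pair; apply: wreath_homM.
have finW := finitely_many_wreath V finG.
have := closure_iter torus Halpha m clw.
apply: (not_closure Ffree alphaM torus Halpha rhoM (finitely_many_pair finW finW) (i0 := 0)).
move=> i h _ Hh [e0 e1]; apply: (sep i); apply/evalE; rewrite /dc /double_cocycle /cocycle e0 e1.
exact/esym/(double_cocycle_sub Ffree Hs actM Hfix Hpath).
Qed.
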